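(* Let $K$ be a field, $S=K[x_1,\ldots,x_n]$ the standard graded polynomial ring, and $I\subset S$ a graded ideal contained in $(x_1,\ldots,x_n)$ of codimension $s$ such that $R=S/I$ is Cohen-Macaulay and has a quasi-pure resolution. Then $R$ satisfies the improved multiplicity conjecture; that is, with $M_i=M_i(I)$, $m_i=m_i(I)$, $$\frac{1}{s!}\prod_{i=1}^s m_i\;\leq\; e(R)\;\leq\;\frac{1}{s!}\prod_{i=1}^s M_i,$$ and if equality holds in either of these two inequalities, then $R$ has a pure resolution.
   Context: Let $$0\to\bigoplus_{j=1}^{b_s} S(-d_{sj})\to\cdots\to\bigoplus_{j=1}^{b_1} S(-d_{1j})\to S\to 0$$ be the graded minimal free $S$-resolution of $R=S/I$ (its length is $s$ since $R$ is Cohen-Macaulay of codimension $s$). For $i=1,\ldots,s$ set $M_i(I)=\max\{d_{ij} : j=1,\ldots,b_i\}$ and $m_i(I)=\min\{d_{ij}: j=1,\ldots,b_i\}$. The resolution is quasi-pure if $m_i(I)\geq M_{i-1}(I)$ for all $i=2,\ldots,s$. It is pure if for every $i$ the shifts $d_{ij}$ do not depend on $j$, i.e. $m_i(I)=M_i(I)$ for all $i$. The codimension of $I$ is its height, and $e(R)$ is the multiplicity of $R$. *)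

(* Defs.v *)
From mathcomp Require Import all_boot all_order all_algebra.
From mathcomp Require Import mpoly.

Set Implicit Arguments.
Unset Strict Implicit.
Unset Printing Implicit Defensive.

Import Order.TTheory GRing.Theory Num.Theory.

Local Open Scope ring_scope.

Section Ideals.

Variables (K : fieldType) (n : nat).
Local Notation S := {mpoly K[n]}.
Implicit Types (I P Q : {pred S}) (fs : seq S).

(* The ideal (x_1, ..., x_n): the polynomials without constant term. *)
Definition irrelevant_ideal : {pred S} := [pred p | p@_0%MM == 0].

Definition graded_ideal I :=
  idealr_closed I /\ forall p d, p \in I -> pihomog mdeg d p \in I.

Definition prime_ideal P := idealr_closed P /\ prime_idealr_closed P.

Definition strict_subideal P Q :=
  {subset P <= Q} /\ exists2 x, x \in Q & x \notin P.

(* A chain C 0 < C 1 < ... < C l of l + 1 primes. *)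
Definition prime_chain l (C : nat -> {pred S}) :=
  (forall i, (i <= l)%N -> prime_ideal (C i)) /\
  (forall i, (i < l)%N -> strict_subideal (C i) (C i.+1)).

Definition prime_height_ge P h :=
  exists C, prime_chain h C /\ C h =i P.

(* The height of I is the minimum of the heights of the primes containing I. *)
Definition height_ge I h :=
  forall P, prime_ideal P -> {subset I <= P} -> prime_height_ge P h.

Definition is_height I h := height_ge I h /\ ~ height_ge I h.+1.

(* Krull dimension of S/I; the primes of S/I are the primes of S above I. *)
Definition quotient_dim_ge I d :=
  exists C, prime_chain d C /\ {subset I <= C 0%N}.

Definition is_quotient_dim I d := quotient_dim_ge I d /\ ~ quotient_dim_ge I d.+1.

(* Membership in the ideal I + (fs). *)
Definition in_ideal_add I fs (g : S) :=
  exists a : nat -> S, g - \sum_(i < size fs) a i * fs`_i \in I.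

(* The classes of fs form an S/I-regular sequence contained in the image of
   (x_1, ..., x_n); the quotient of S/I by fs is then nonzero as soon as I is
   itself contained in (x_1, ..., x_n). *)
Definition regular_sequence I fs :=
  {subset fs <= irrelevant_ideal} /\
  forall i, (i < size fs)%N ->
    forall g, in_ideal_add I (take i fs) (g * fs`_i) ->
              in_ideal_add I (take i fs) g.

Definition depth_ge I d := exists2 fs, regular_sequence I fs & size fs = d.

Definition is_depth I d := depth_ge I d /\ ~ depth_ge I d.+1.

(* The graded algebra S/I is Cohen-Macaulay: depth S/I = dim S/I, the depth
   being taken with respect to the graded maximal ideal. *)
Definition cohen_macaulay I := exists d, is_depth I d /\ is_quotient_dim I d.

(* h = dim_K (S/I)_k: there are h forms of degree k whose classes are a
   K-basis of S_k / I_k. *)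
Definition is_graded_dim I (k h : nat) :=
  exists b : 'I_h -> S,
    [/\ forall i, b i \is k.-homog,
        forall c : 'I_h -> K, \sum_i c i *: b i \in I -> forall i, c i = 0
      & forall p, p \is k.-homog ->
          exists c : 'I_h -> K, p - \sum_i c i *: b i \in I].

(* Multiplicity of S/I: with P the Hilbert polynomial, (deg P)! times the
   leading coefficient of P if P is nonzero (then deg P = dim S/I - 1), and
   dim_K S/I otherwise. *)
Definition is_multiplicity I (e : rat) :=
  exists (H : nat -> nat) (P : {poly rat}) (N : nat),
    [/\ forall k, is_graded_dim I k (H k),
        forall k, (N <= k)%N -> (H k)%:R = P.[k%:R]
      & e = if P == 0 then (\sum_(k < N) H k)%N%:R
            else ((size P).-1)`!%:R * lead_coef P].

End Ideals.

Arguments irrelevant_ideal : clear implicits.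

Section Resolutions.

Variables (K : fieldType) (n : nat).
Local Notation S := {mpoly K[n]}.

(* F_i = \bigoplus_j S(- shift i j), with elements written as row vectors, and
   the map F_(i+1) -> F_i given by right multiplication by diff i. *)
Record graded_free_seq := GradedFreeSeq {
  rank : nat -> nat;
  shift : forall i, 'I_(rank i) -> nat;
  diff : forall i, 'M[S]_(rank i.+1, rank i)
}.

Arguments shift : clear implicits.

Definition homogeneous_maps (F : graded_free_seq) :=
  forall i j k m, m \in msupp (diff F i j k) ->
    (mdeg m + shift F i k)%N = shift F i.+1 j.

Definition minimal_maps (F : graded_free_seq) :=
  forall i j k, diff F i j k \in irrelevant_ideal K n.

(* F is a graded minimal free resolution of S/I with F_0 = S (so that
   const_mx p below is the row vector of length rank F 0 = 1 with entry p). *)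
Definition minimal_graded_resolution (I : {pred S}) (F : graded_free_seq) :=
  [/\ rank F 0 = 1%N /\ (forall j, shift F 0 j = 0%N),
      homogeneous_maps F,
      minimal_maps F,
      forall p : S, p \in I <->
        exists u : 'rV[S]_(rank F 1), u *m diff F 0 = const_mx p
    & forall i (u : 'rV[S]_(rank F i.+1)), u *m diff F i = 0 <->
        exists v : 'rV[S]_(rank F i.+2), u = v *m diff F i.+1].

Definition resolution_length (F : graded_free_seq) (s : nat) :=
  forall i, (0 < rank F i)%N = (i <= s)%N.

Definition max_shift (F : graded_free_seq) (i : nat) : nat :=
  (\max_(j < rank F i) shift F i j)%N.

(* minn has no neutral element on nat; starting from the maximum yields the
   minimum whenever rank F i > 0. *)
Definition min_shift (F : graded_free_seq) (i : nat) : nat :=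
  (\big[minn/max_shift F i]_(j < rank F i) shift F i j)%N.

Definition quasi_pure (F : graded_free_seq) (s : nat) :=
  forall i, (2 <= i <= s)%N -> (max_shift F i.-1 <= min_shift F i)%N.

Definition pure (F : graded_free_seq) (s : nat) :=
  forall i, (1 <= i <= s)%N -> min_shift F i = max_shift F i.

End Resolutions.

Arguments shift {K n}.

(* Main.v *)
Require Import Defs.
From HB Require Import structures.
From mathcomp Require Import all_boot all_order all_algebra.
From mathcomp Require Import mpoly.
From mathcomp Require classical_sets boolp.
From mathcomp Require Import zify ring.

Set Implicit Arguments.
Unset Strict Implicit.
Unset Printing Implicit Defensive.

Import Order.TTheory GRing.Theory Num.Theory.

Local Open Scope ring_scope.

(** Write [d_ij] for the shifts of the resolution and
    [k(t) = sum_i (-1)^i sum_j t^d_ij], so that the Hilbert series of [S/I] is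
    [k(t) / (1-t)^n].

    Numerical part.  Suppose that [k(t) = (1-t)^s h(t)].  The linear form that
    sends [t^d] to [p(d)], for a monic polynomial [p] of degree [s], takes the
    value [(-1)^s s! h(1)] on [k] (Peskine and Szpiro; [node_sum_order]).  For
    [p = prod_i (X - r_i)] the term [i = 0] contributes [(-1)^s prod_i r_i], so
    [s! h(1) - prod_i r_i] is the sum of the numbers [(-1)^(s+i) p(d_ij)] over
    [i >= 1].  Because the resolution is quasi-pure, the shifts of step [i] lie
    between [r_i] and [r_(i+1)] when [r_i = m_i], and between [r_(i-1)] and
    [r_i] when [r_i = M_i]; hence all these numbers are nonnegative in the
    first case and nonpositive in the second.  This gives both inequalities
    for [h(1)] ([node_lower], [node_upper]), the inequality [h(1) > 0], and,
    in case of equality, that every [d_ij] is one of the [r_k].  Since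
    [m_i < m_(i+1)] and [M_i < M_(i+1)], the resolution is then pure: for the
    upper bound by induction on [i], for the lower bound by descending
    induction.

    Divisibility by [(1-t)^s].  Let [l] be the largest size of a set [A] of
    variables with [I] and [K[A]] meeting only in [0].  Some prime [P]
    containing [I] has the same property for [A] ([prime_over_independent]).
    In a strict chain of primes the order of growth of the dimension of the
    polynomials of degree at most [k] modulo the prime drops at each step, so a
    chain of length [s] ending at [P] forces [l + s <= n]
    ([height_independent]).  On the other hand that dimension for [I] is
    [O(k^l)], by counting the monomials outside the initial ideal
    ([growth_le_independent]).  Thus it is [O(k^(n-s))], and a pole of
    [k(t) / (1-t)^n] at [1] of order greater than [n - s] is impossible
    ([growth_order]).  As [h(1)] is nonzero, it is the multiplicity
    ([series_multiplicity]).

    Strictness.  Minimality gives [m_i < m_(i+1)]: no row of a differential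
    vanishes.  For [M_i < M_(i+1)] no column may vanish, that is, no basis
    vector of the dual complex may be a cocycle, and this holds if the dual
    complex is exact in degrees [1 <= i < s].  That exactness follows from a
    regular sequence of length [s] in [I] ([dual_exact]); the slow growth of
    [S/I] provides one, by Noether normalization and induction on the number
    of variables ([slow_growth_regular]). *)

(** * The Peskine-Szpiro equations *)

(** The linear form ['X^d |-> p.[d]] on polynomials, evaluated at [q]. *)
Definition node_sum (p q : {poly rat}) : rat :=
  \sum_(d < size q) q`_d * p.[d%:R].

Lemma node_sum_wide N (p q : {poly rat}) : (size q <= N)%N ->
  node_sum p q = \sum_(d < N) q`_d * p.[d%:R].
Proof.
move=> le_qN; rewrite /node_sum (big_ord_widen N (fun d => q`_d * p.[d%:R]) le_qN).
rewrite [RHS](bigID (fun d : 'I_N => (d < size q)%N)) /=.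
rewrite [X in _ + X]big1 ?addr0 // => d; rewrite -leqNgt => led.
by rewrite nth_default ?mul0r.
Qed.

Lemma node_sumD p q1 q2 : node_sum p (q1 + q2) = node_sum p q1 + node_sum p q2.
Proof.
rewrite !(@node_sum_wide (maxn (size q1) (size q2)))
  ?size_polyD ?leq_maxl ?leq_maxr // -big_split /=.
by apply: eq_bigr => d _; rewrite coefD mulrDl.
Qed.

Lemma node_sumZ p c q : node_sum p (c *: q) = c * node_sum p q.
Proof.
rewrite !(@node_sum_wide (size q)) ?size_scale_leq // mulr_sumr.
by apply: eq_bigr => d _; rewrite coefZ mulrA.
Qed.

Lemma node_sum0 p : node_sum p 0 = 0.
Proof. by rewrite -(scale0r 0) node_sumZ mul0r. Qed.

Lemma node_sum_sum p (T : Type) (r : seq T) (Q : T -> {poly rat}) :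
  node_sum p (\sum_(i <- r) Q i) = \sum_(i <- r) node_sum p (Q i).
Proof.
by elim: r => [|x r IH]; rewrite ?(big_nil, node_sum0) // !big_cons node_sumD IH.
Qed.

Lemma node_sumXn p d : node_sum p 'X^d = p.[d%:R].
Proof.
rewrite (@node_sum_wide d.+1) ?size_polyXn // big_ord_recr /= coefXn eqxx mul1r.
rewrite big1 ?add0r // => i _; rewrite coefXn.
by rewrite (ltn_eqF (ltn_ord i)) mul0r.
Qed.

(** Summation by parts: multiplying the weights by [1 - 'X] is the same as
    replacing the evaluated polynomial by its difference. *)
Lemma node_sum_diff p q :
  node_sum p ((1 - 'X) * q) = node_sum (p - (p \Po ('X + 1))) q.
Proof.
have sz : (size ((1 - 'X) * q)%R <= (size q).+1)%N.
  apply: leq_trans (size_polyMleq _ _) _.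
  by rewrite -opprB size_polyN size_XsubC.
rewrite (node_sum_wide _ sz) (@node_sum_wide (size q)) //.
under eq_bigr => d _ do rewrite mulrBl mul1r coefB mulrBl.
rewrite sumrB big_ord_recr /= nth_default // mul0r addr0.
rewrite [X in _ - X]big_ord_recl /= coefXM /= mul0r add0r -sumrB.
apply: eq_bigr => d _; rewrite coefXM /= hornerD hornerN horner_comp !hornerE.
by rewrite mulrBr /bump /= add1n -natr1.
Qed.

Lemma size_coef_diff m (p : {poly rat}) : (size p <= m.+2)%N ->
  let q := p - (p \Po ('X + 1)) in
  (size q <= m.+1)%N /\ q`_m = - m.+1%:R * p`_m.+1.
Proof.
move=> szp q.
have qE l : (m <= l)%N -> q`_l = p`_l -
    (p`_m * 'C(m, l)%:R + p`_m.+1 * 'C(m.+1, l)%:R).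
  move=> le_ml; rewrite coefB comp_polyE coef_sum; congr (_ - _).
  transitivity (\sum_(k < m.+2) p`_k * 'C(k, l)%:R).
    rewrite (big_ord_widen _ (fun k => (p`_k *: ('X + 1) ^+ k)`_l) szp) /=.
    rewrite big_mkcond; apply: eq_bigr => k _.
    have -> : (p`_k *: ('X + 1) ^+ k)`_l = p`_k * 'C(k, l)%:R.
      rewrite coefZ exprD1n coef_sum; congr (_ * _).
      under eq_bigr => i _ do rewrite coefMn coefXn.
      case: (ltnP l k.+1) => lk.
        rewrite (bigD1 (Ordinal lk)) //= eqxx big1 ?addr0 // => i ni.
        case: eqP => [E|]; last by rewrite mul0rn.
        by case/eqP: ni; apply: val_inj.
      rewrite big1 ?bin_small // => i _.
      by rewrite gtn_eqF ?mul0rn // (leq_trans (ltn_ord i)).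
    by case: ifP => // /negbT; rewrite -leqNgt => h; rewrite nth_default ?mul0r.
  rewrite !big_ord_recr /= big1 ?add0r // => k _.
  by rewrite bin_small ?mulr0 // (leq_trans (ltn_ord k)).
split; last first.
  by rewrite qE // binn (binSn m); ring.
apply/leq_sizeP => l lt_ml; rewrite qE; last exact: ltnW.
rewrite (@bin_small m) // mulr0 add0r.
case: (eqVneq l m.+1) => [->|ne]; first by rewrite binn mulr1 subrr.
have lt : (m.+1 < l)%N by rewrite ltn_neqAle eq_sym ne.
by rewrite bin_small // mulr0 subr0 nth_default //; apply: leq_trans szp lt.
Qed.

(** Each factor [1 - 'X] of the weights lowers the degree of the evaluated
    polynomial by one and multiplies its leading coefficient by minus the
    degree. *)
Lemma node_sum_order m (p h : {poly rat}) : (size p <= m.+1)%N ->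
  node_sum p ((1 - 'X) ^+ m * h) = (-1) ^+ m * m`!%:R * p`_m * h.[1].
Proof.
elim: m p h => [|m IH] p h szp.
  rewrite !expr0 !mul1r; have -> : p = (p`_0)%:P by apply: size1_polyC.
  rewrite coefC eqxx horner_coef mulr_sumr; apply: eq_bigr => d _.
  by rewrite hornerC expr1n mulr1 mulrC.
have [szq qm] := size_coef_diff szp.
by rewrite exprS -mulrA node_sum_diff IH // qm factS natrM exprS; ring.
Qed.

Definition node_poly (s : nat) (r : nat -> nat) : {poly rat} :=
  \prod_(1 <= k < s.+1) ('X - (r k)%:R%:P).

Lemma node_polyE s r x :
  (node_poly s r).[x] = \prod_(1 <= k < s.+1) (x - (r k)%:R).
Proof.
by rewrite horner_prod; apply: eq_bigr => k _; rewrite !hornerE.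
Qed.

Lemma node_poly_monic s r : node_poly s r \is monic.
Proof. by apply: monic_prod => k _; rewrite monicXsubC. Qed.

Lemma size_node_poly s r : size (node_poly s r) = s.+1.
Proof.
by rewrite /node_poly size_prod_seq_XsubC_size || by rewrite
  /node_poly -(big_map (fun k => (r k)%:R : rat) xpredT (fun a => 'X - a%:P))
  size_prod_XsubC size_map size_iota subn1.
Qed.

(** The factors of index greater than [i], which are [s - i] in number, are
    nonpositive, and the others are nonnegative. *)
Lemma sign_node_poly s i r x : (i <= s)%N ->
  (forall k, (0 < k <= i)%N -> (r k <= x)%N) ->
  (forall k, (i < k <= s)%N -> (x <= r k)%N) ->
  0 <= (-1) ^+ (s + i) * (node_poly s r).[x%:R].
Proof.
move=> le_is lo hi; rewrite node_polyE (@big_cat_nat _ _ _ i.+1) //=.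
have -> : \prod_(i.+1 <= k < s.+1) (x%:R - (r k)%:R) =
    (-1) ^+ (s - i) * \prod_(i.+1 <= k < s.+1) ((r k)%:R - x%:R) :> rat.
  under eq_bigr => k _ do rewrite -opprB -mulN1r.
  by rewrite big_split /= prodr_const_nat subSS.
rewrite mulrCA [X in _ * X]mulrA -exprD.
have -> : (s + i + (s - i) = 2 * s)%N by lia.
rewrite exprM sqrrN !expr1n mul1r mulr_ge0 // big_nat prodr_ge0 // => k /andP[h1 h2].
  by rewrite subr_ge0 ler_nat lo // h1 -ltnS.
by rewrite subr_ge0 ler_nat hi // h1.
Qed.

Section NodeIdentity.

Variables (s : nat) (rk : nat -> nat) (d : forall i, 'I_(rk i) -> nat).
Variable h : {poly rat}.
Hypotheses (rk0 : rk 0%N = 1%N) (d0 : forall j, @d 0%N j = 0%N).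
Hypothesis kE :
  \sum_(i < s.+1) (-1) ^+ i *: \sum_(j < rk i) 'X^(@d i j) = (1 - 'X) ^+ s * h.

(** The step [i = 0] of the resolution, whose only shift is [0], contributes
    the product of the nodes. *)
Lemma node_identity (r : nat -> nat) :
  s`!%:R * h.[1] = \prod_(1 <= k < s.+1) (r k)%:R +
    \sum_(1 <= i < s.+1) \sum_(j < rk i)
      (-1) ^+ (s + i) * (node_poly s r).[(@d i j)%:R].
Proof.
have := congr1 (node_sum (node_poly s r)) kE.
rewrite node_sum_order ?size_node_poly //.
have -> : (node_poly s r)`_s = 1.
  by have /eqP := node_poly_monic s r; rewrite lead_coefE size_node_poly.
rewrite mulr1 node_sum_sum => E.
have -> : s`!%:R * h.[1] = (-1) ^+ s * ((-1) ^+ s * s`!%:R * h.[1]).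
  by rewrite !mulrA -exprD addnn -mul2n exprM sqrrN !expr1n mul1r.
rewrite -E mulr_sumr big_ord_recl; congr (_ + _); last rewrite big_add1 big_mkord.
  rewrite /= expr0 scale1r node_sum_sum.
  rewrite (eq_bigr (fun=> (node_poly s r).[0])); last first.
    by move=> j _; rewrite node_sumXn (_ : d j = 0%N) ?(d0 j).
  rewrite sumr_const card_ord rk0 mulr1n node_polyE.
  have -> : (-1) ^+ s = \prod_(1 <= k < s.+1) (-1) :> rat.
    by rewrite prodr_const_nat subn1.
  rewrite -big_split /=; apply: eq_bigr => k _.
  by rewrite sub0r mulrNN mul1r.
apply: eq_bigr => i _ /=; rewrite node_sumZ node_sum_sum mulrA -exprD mulr_sumr.
by apply: eq_bigr => j _; rewrite node_sumXn.
Qed.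

Variables m M : nat -> nat.
Hypothesis md : forall i j, (1 <= i <= s)%N -> (m i <= @d i j <= M i)%N.
Hypothesis Mm : forall i, (2 <= i <= s)%N -> (M i.-1 <= m i)%N.
Hypothesis mM : forall i, (1 <= i <= s)%N -> (m i <= M i)%N.

Let Mm_lt k i : (1 <= k < i)%N -> (i <= s)%N -> (M k <= m i)%N.
Proof.
elim: i => [|i IH] /andP[k1]; first by case: (k).
 rewrite ltnS leq_eqVlt => /orP[/eqP<- ks|ki lis].
  by apply: (@Mm k.+1); rewrite ltnS k1.
apply: leq_trans (@Mm i.+1 _); last by rewrite lis andbT; lia.
by apply: leq_trans (IH _ _) (mM _); lia.
Qed.

Let term_lower i j : (1 <= i <= s)%N ->
  0 <= (-1) ^+ (s + i) * (node_poly s m).[(@d i j)%:R].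
Proof.
move=> i1s; have /andP[i1 lis] := i1s; have /andP[mi Mi] := md j i1s.
apply: sign_node_poly => // k hk.
  apply: leq_trans mi; case: (eqVneq k i) => [->//|nki].
  by apply: leq_trans (mM _) (Mm_lt _ _) => //; lia.
by apply: leq_trans Mi (Mm_lt _ _); lia.
Qed.

(* The sign changes with respect to [term_lower], since here the shifts of step
   [i] lie to the left of the [i]-th node. *)
Let term_upper i j : (1 <= i <= s)%N ->
  (-1) ^+ (s + i) * (node_poly s M).[(@d i j)%:R] <= 0.
Proof.
move=> i1s; have /andP[i1 lis] := i1s; have /andP[mi Mi] := md j i1s.
rewrite -oppr_ge0 -mulNr.
have -> : - (-1) ^+ (s + i) = (-1) ^+ (s + i.-1) :> rat.
  by rewrite -{1}(prednK i1) addnS exprS; ring.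
apply: sign_node_poly => [|k hk|k hk]; first lia.
  by apply: leq_trans mi; apply: Mm_lt; lia.
apply: leq_trans Mi _; case: (eqVneq k i) => [->//|nki].
by apply: leq_trans (Mm_lt _ _) (mM _); lia.
Qed.

Let root_of_node r i j : (1 <= i <= s)%N ->
  (-1) ^+ (s + i) * (node_poly s r).[(@d i j)%:R] = 0 ->
  exists2 k, (1 <= k <= s)%N & @d i j = r k.
Proof.
move=> _ /eqP; rewrite mulf_eq0 expf_eq0 oppr_eq0 oner_eq0 andbF /=.
rewrite node_polyE prodf_seq_eq0 => /hasP[k].
rewrite mem_index_iota subr_eq0 eqr_nat => hk /eqP E.
by exists k.
Qed.

Lemma node_lower : \prod_(1 <= k < s.+1) (m k)%:R <= s`!%:R * h.[1].
Proof.
rewrite (node_identity m) lerDl big_nat sumr_ge0 // => i hi.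
by apply: sumr_ge0 => j _; apply: term_lower.
Qed.

Lemma node_upper : s`!%:R * h.[1] <= \prod_(1 <= k < s.+1) (M k)%:R.
Proof.
rewrite (node_identity M) gerDl big_nat sumr_le0 // => i hi.
by apply: sumr_le0 => j _; apply: term_upper.
Qed.

Lemma node_lower_eq : s`!%:R * h.[1] = \prod_(1 <= k < s.+1) (m k)%:R ->
  forall i j, (1 <= i <= s)%N -> exists2 k, (1 <= k <= s)%N & @d i j = m k.
Proof.
rewrite (node_identity m) -[RHS]addr0 => /addrI /eqP.
rewrite big_nat psumr_eq0 => [/allP E i j hi|i hi]; last first.
  by apply: sumr_ge0 => j _; apply: term_lower.
have := E i; rewrite mem_index_iota ltnS => /(_ hi); rewrite hi /=.
rewrite psumr_eq0 => [/allP/(_ j)|k _]; last exact: term_lower.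
by rewrite mem_index_enum => /(_ isT) /eqP; apply: root_of_node.
Qed.

Lemma node_upper_eq : s`!%:R * h.[1] = \prod_(1 <= k < s.+1) (M k)%:R ->
  forall i j, (1 <= i <= s)%N -> exists2 k, (1 <= k <= s)%N & @d i j = M k.
Proof.
rewrite (node_identity M) -[RHS]addr0 => /addrI /eqP.
rewrite big_nat -oppr_eq0 -sumrN psumr_eq0 => [/allP E i j hi|i hi]; last first.
  by rewrite oppr_ge0; apply: sumr_le0 => j _; apply: term_upper.
have := E i; rewrite mem_index_iota ltnS => /(_ hi); rewrite hi /=.
rewrite -sumrN psumr_eq0 => [/allP/(_ j)|k _]; last first.
  by rewrite oppr_ge0; apply: term_upper.
by rewrite mem_index_enum oppr_eq0 => /(_ isT) /eqP; apply: root_of_node.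
Qed.

End NodeIdentity.

(** * Dimension of a linear predicate *)

Section LinearPredicates.

Variable K : fieldType.

Definition linear_pred (V : lmodType K) (W : V -> Prop) :=
  W 0 /\ forall c u v, W u -> W v -> W (c *: u + v).

Definition free_modulo (V : lmodType K) (W : V -> Prop) (T : finType)
    (b : T -> V) :=
  forall c : T -> K, W (\sum_i c i *: b i) -> forall i, c i = 0.

Definition spans_modulo (V : lmodType K) (W : V -> Prop) (T : finType)
    (b : T -> V) (v : V) :=
  exists c : T -> K, W (v - \sum_i c i *: b i).

(** Bases are indexed by arbitrary finite types, so that they can be glued by
    disjoint union. *)
Definition has_dim (V : lmodType K) (W : V -> Prop) (m : nat) :=
  exists (T : finType) (b : T -> V),
    [/\ #|T| = m, forall i, W (b i), free_modulo (eq^~ 0) b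
      & forall v, W v -> spans_modulo (eq^~ 0) b v].

Lemma linear_pred_sum (V : lmodType K) (W : V -> Prop) (T : Type) (r : seq T)
    (c : T -> K) (b : T -> V) :
  linear_pred W -> (forall i, W (b i)) -> W (\sum_(i <- r) c i *: b i).
Proof.
case=> W0 WD Wb; elim: r => [|x r IH]; first by rewrite big_nil.
by rewrite big_cons; apply: WD.
Qed.

Lemma linear_pred0 (V : lmodType K) : linear_pred (fun v : V => v = 0).
Proof. by split=> // c u v -> ->; rewrite scaler0 addr0. Qed.

Lemma linear_predD (V : lmodType K) (W : V -> Prop) u v :
  linear_pred W -> W u -> W v -> W (u + v).
Proof. by case=> _ WD Wu Wv; rewrite -[u]scale1r; apply: WD. Qed.

(** A family with more members than the spanning one has a nontrivial relation:
    the matrix of its coordinates has a nonzero row kernel. *)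
Lemma free_card_le (V : lmodType K) (W : V -> Prop) (T T' : finType)
    (v : T -> V) (w : T' -> V) :
  linear_pred W -> free_modulo W v -> (forall i, spans_modulo W w (v i)) ->
  (#|T| <= #|T'|)%N.
Proof.
move=> linW freev /boolp.choice[A AE]; rewrite leqNgt; apply/negP => lt.
pose B : 'M[K]_(#|T|, #|T'|) := \matrix_(i, j) A (enum_val i) (enum_val j).
have /rowV0Pn[u uker u0] : kermx B != 0.
  by rewrite -mxrank_eq0 mxrank_ker subn_eq0 -ltnNge (leq_ltn_trans (rank_leq_col B)).
move/sub_kermxP: uker => uB.
have ci0 : forall i : T, u 0 (enum_rank i) = 0.
  apply: freev.
  suff -> : \sum_(i : T) u 0 (enum_rank i) *: v i =
      \sum_(i : T) u 0 (enum_rank i) *: (v i - \sum_j A i j *: w j).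
    exact: linear_pred_sum.
  under [RHS]eq_bigr => i _ do rewrite scalerBr scaler_sumr.
  rewrite sumrB [X in _ - X](_ : _ = 0) ?subr0 // exchange_big big1 //= => j _.
  under eq_bigr => i _ do rewrite scalerA.
  rewrite -scaler_suml.
  have := congr1 (fun M : 'rV_#|T'| => M 0 (enum_rank j)) uB; rewrite !mxE.
  rewrite (reindex (@enum_rank T)) /=; last first.
    by apply: onW_bij; apply: enum_rank_bij.
  under eq_bigr => i _ do rewrite !mxE !enum_rankK.
  by move=> ->; rewrite scale0r.
case/negP: u0; apply/eqP/rowP => i.
by rewrite mxE -(ci0 (enum_val i)) enum_valK.
Qed.

Lemma has_dim_uniq (V : lmodType K) (W : V -> Prop) m m' :
  has_dim W m -> has_dim W m' -> m = m'.
Proof.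
move=> [T [b [<- bW bf bs]]] [T' [b' [<- bW' bf' bs']]].
have lin0 := @linear_pred0 V.
apply/eqP; rewrite eqn_leq; apply/andP; split.
  by apply: (free_card_le lin0 bf) => i; apply: bs'.
by apply: (free_card_le lin0 bf') => i; apply: bs.
Qed.

Lemma eq_has_dim (V : lmodType K) (W W' : V -> Prop) m :
  (forall v, W v <-> W' v) -> has_dim W m -> has_dim W' m.
Proof.
move=> E [T [b [<- bW bf bs]]]; exists T, b; split=> // [i|v /E /bs //].
exact/E.
Qed.

(** Take a matrix of maximal rank among those with rows in the subspace. *)
Lemma row_space_pred m (W : 'rV[K]_m -> Prop) :
  linear_pred W -> exists M : 'M[K]_m, forall v, W v <-> (v <= M)%MS.
Proof.
move=> linW.
pose P r := boolp.asbool
  (exists2 M : 'M[K]_m, \rank M = r & forall v : 'rV_m, (v <= M)%MS -> W v).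
have P0 : exists r, P r.
  exists 0%N; apply/boolp.asboolP; exists 0; first exact: mxrank0.
  by move=> v; rewrite submx0 => /eqP ->; case: linW.
have Pb r : P r -> (r <= m)%N by case/boolp.asboolP => M <- _; exact: rank_leq_row.
case: (ex_maxnP P0 Pb) => r /boolp.asboolP[M rM MW] rmax.
exists M => v; split=> [Wv|]; last exact: MW.
have : P (\rank (M + v)%MS).
  apply/boolp.asboolP; exists (M + v)%MS => // u /sub_addsmxP[[a c]] /= ->.
  apply: linear_predD => //; first by apply: MW; exact: submxMl.
  by rewrite (mx11_scalar c) mul_scalar_mx -[X in W X]addr0; case: linW => W0; apply.
move/rmax; rewrite -rM => le.
have /eqmxP/eqmx_sym eqM : (M == M + v)%MS.
  rewrite -(geq_leqif (mxrank_leqif_eq _)) //; exact: addsmxSl.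
by rewrite -eqM; exact: addsmxSr.
Qed.

(** In coordinates the kernel of [f] is the row space of a matrix [M], and the
    rows of a complement of [M] map to a basis of the image. *)
Lemma rank_nullity (V V' : lmodType K) (f : {linear V -> V'}) (W : V -> Prop) m :
  linear_pred W -> has_dim W m ->
  exists a b, [/\ has_dim (fun v => W v /\ f v = 0) a,
    has_dim (fun w => exists2 v, W v & w = f v) b & (a + b)%N = m].
Proof.
move=> linW [T [b [<- bW bf bs]]].
pose g (u : 'rV[K]_#|T|) : V := \sum_(i : T) u 0 (enum_rank i) *: b i.
have gD c u v : g (c *: u + v) = c *: g u + g v.
  rewrite /g scaler_sumr -big_split; apply: eq_bigr => i _.
  by rewrite !mxE scalerDl scalerA.
have g0 : g 0 = 0 by rewrite /g big1 // => i _; rewrite mxE scale0r.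
have gI u : g u = 0 -> u = 0.
  move=> /bf u0; apply/rowP => i; rewrite mxE.
  by have := u0 (enum_val i); rewrite enum_valK.
have gS v : W v -> exists u, v = g u.
  move=> /bs[c] /eqP; rewrite subr_eq0 => /eqP ->.
  exists (\row_i c (enum_val i)); apply: eq_bigr => i _.
  by rewrite mxE enum_rankK.
have gW u : W (g u) by apply: linear_pred_sum.
have gsum (I : finType) (c : I -> K) (r : I -> 'rV_#|T|) :
    g (\sum_i c i *: r i) = \sum_i c i *: g (r i).
  rewrite (big_morph g (id1 := 0) (op1 := +%R)) //.
    by apply: eq_bigr => i _; rewrite -[c i *: r i]addr0 gD g0 addr0.
  by move=> u v; rewrite -[u]scale1r gD !scale1r.
have [M ME] : exists M : 'M[K]_#|T|, forall u, f (g u) = 0 <-> (u <= M)%MS.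
  apply: row_space_pred; split; first by rewrite g0 linear0.
  by move=> c u v fu fv; rewrite gD linearP fu fv scaler0 addr0.
exists (\rank M), (\rank (M^C)%MS); split; last first.
- by rewrite mxrank_compl subnKC // rank_leq_row.
- exists 'I_(\rank (M^C)%MS), (fun i => f (g (row i (row_base (M^C)%MS)))).
  split; first exact: card_ord.
  + by move=> i; exists (g (row i (row_base (M^C)%MS))).
  + move=> c; under eq_bigr => i _ do rewrite -linearZ.
    rewrite -linear_sum -gsum => /ME.
    have -> : \sum_i c i *: row i (row_base (M^C)%MS) =
        (\row_i c i) *m row_base (M^C)%MS.
      by rewrite mulmx_sum_row; apply: eq_bigr => i _; rewrite mxE.
    set u := _ *m _ => uM.
    have uC : (u <= M^C)%MS by rewrite -(eq_row_base (M^C)%MS) submxMl.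
    have : (u <= M :&: M^C)%MS by rewrite sub_capmx uM uC.
    rewrite capmx_compl submx0 mulmx_free_eq0 ?row_base_free //.
    by move=> /eqP/rowP u0 i; have := u0 i; rewrite !mxE.
  + move=> w [v /gS[u ->] ->].
    have /sub_addsmxP[[a c] /= ->] : (u <= M + M^C)%MS.
      by rewrite submx_full // addsmx_compl_full.
    have /submxP[D DE] : (c *m (M^C)%MS <= row_base (M^C)%MS)%MS.
      by rewrite eq_row_base submxMl.
    exists (fun i => D 0 i); under eq_bigr => i _ do rewrite -linearZ.
    rewrite -linear_sum -gsum -linearB.
    rewrite DE -[a *m M]scale1r gD [D *m _]mulmx_sum_row linearB linearP.
    have /ME -> : (a *m M <= M)%MS by exact: submxMl.
    by rewrite scaler0 add0r subrr.
- exists 'I_(\rank M), (fun i => g (row i (row_base M))).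
  split; first exact: card_ord.
  + move=> i; split=> //; apply/ME.
    by rewrite -(eq_row_base M) row_sub.
  + move=> c; rewrite -gsum => /gI.
    have -> : \sum_i c i *: row i (row_base M) = (\row_i c i) *m row_base M.
      by rewrite mulmx_sum_row; apply: eq_bigr => i _; rewrite mxE.
    move/eqP; rewrite mulmx_free_eq0 ?row_base_free //.
    by move=> /eqP/rowP u0 i; have := u0 i; rewrite !mxE.
  + move=> v [/gS[u ->] /ME]; rewrite -(eq_row_base M) => /submxP[D ->].
    by exists (fun i => D 0 i); rewrite -gsum -mulmx_sum_row subrr.
Qed.

End LinearPredicates.

(** * The Hilbert function of a graded resolution *)

Section Restriction.

Variables (K : fieldType) (n : nat).
Local Notation S := {mpoly K[n]}.
Implicit Types (p q : S) (m : 'X_{1..n}).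

(** Degree components, and more generally the part of a polynomial carried by a
    set of monomials. *)
Definition mrestrict (P : pred 'X_{1..n}) p : S :=
  \sum_(m <- msupp p | P m) p@_m *: 'X_[m].

Lemma mcoeff_mrestrict P p m :
  (mrestrict P p)@_m = if P m then p@_m else 0.
Proof.
rewrite /mrestrict raddf_sum /=.
under eq_bigr => m' _ do rewrite mcoeffZ mcoeffX.
have [mp|mp] := boolP (m \in msupp p); last first.
  rewrite (memN_msupp_eq0 mp) if_same big_seq_cond big1 // => m' /andP[m'p _].
  by case: eqP => [E|]; [rewrite -E m'p in mp | rewrite mulr0].
rewrite big_mkcond (bigD1_seq m) //= eqxx mulr1 big1 ?addr0 // => m' /negPf ->.
by rewrite mulr0 if_same.
Qed.

Lemma msupp_mrestrict P p m : (m \in msupp (mrestrict P p)) = P m && (m \in msupp p).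
Proof. by rewrite !mcoeff_msupp mcoeff_mrestrict; case: (P m); rewrite ?eqxx. Qed.

Lemma mrestrict_sum P (T : Type) (r : seq T) (f : T -> S) :
  mrestrict P (\sum_(i <- r) f i) = \sum_(i <- r) mrestrict P (f i).
Proof.
apply/mpolyP => m; rewrite mcoeff_mrestrict !raddf_sum /=.
case: ifP => Pm; last by rewrite big1 // => i _; rewrite mcoeff_mrestrict Pm.
by apply: eq_bigr => i _; rewrite mcoeff_mrestrict Pm.
Qed.

Lemma mrestrict_id (P : pred 'X_{1..n}) p : (forall m, m \in msupp p -> P m) -> mrestrict P p = p.
Proof.
move=> Pp; apply/mpolyP => m; rewrite mcoeff_mrestrict; case: ifP => // /negbT nP.
by rewrite memN_msupp_eq0 //; apply: contra nP => /Pp.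
Qed.

Lemma pihomog_mrestrict d p : pihomog mdeg d p = mrestrict (fun m => mdeg m == d) p.
Proof. by []. Qed.

(** A factor [q] that shifts degrees from [b] to [a] commutes with taking the
    component of degree [k]. *)
Lemma mrestrictM a b k p q :
  (forall m, m \in msupp q -> (mdeg m + a)%N = b) ->
  mrestrict (fun m => mdeg m + a == k)%N (p * q) =
  mrestrict (fun m => mdeg m + b == k)%N p * q.
Proof.
move=> hq; apply/mpolyP => m; rewrite mcoeff_mrestrict !mcoeffM.
case: ifPn => hm.
  apply: eq_bigr => x /eqP xm; rewrite mcoeff_mrestrict.
  have [xq|/memN_msupp_eq0 ->] := boolP (bmnm x.2 \in msupp q); last by rewrite !mulr0.
  suff -> : (mdeg x.1 + b == k)%N by [].
  by rewrite -(eqP hm) -(hq _ xq) addnA -mdegD -xm.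
rewrite big1 // => x /eqP xm; rewrite mcoeff_mrestrict.
have [xq|/memN_msupp_eq0 ->] := boolP (bmnm x.2 \in msupp q); last by rewrite !mulr0.
suff /negPf -> : (mdeg x.1 + b != k)%N by rewrite mul0r.
by apply: contra hm => /eqP <-; rewrite -(hq _ xq) addnA -mdegD -xm.
Qed.

End Restriction.

Section Strands.

Variables (K : fieldType) (n : nat).
Local Notation S := {mpoly K[n]}.
Variables (I : {pred S}) (F : graded_free_seq K n).
Hypothesis I_graded : graded_ideal I.
Hypothesis F_res : minimal_graded_resolution I F.

(** [{ffun _ -> S}] rather than row vectors: it is a vector space over [K]. *)
Local Notation V i := {ffun 'I_(rank F i) -> S}.

Definition row_map i (u : V i.+1) : V i :=
  [ffun l => \sum_j u j * diff F i j l].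

Lemma row_map_linear i : linear (@row_map i).
Proof.
move=> c u v; apply/ffunP => l; rewrite !ffunE scaler_sumr -big_split /=.
by apply: eq_bigr => j _; rewrite !ffunE mulrDl scalerAl.
Qed.

HB.instance Definition _ i :=
  GRing.isLinear.Build K (V i.+1) (V i) _ (@row_map i) (@row_map_linear i).

Lemma row_mapE i (u : V i.+1) :
  (\row_j u j) *m diff F i = \row_l row_map u l.
Proof.
by apply/rowP => l; rewrite !mxE ffunE; apply: eq_bigr => j _; rewrite mxE.
Qed.

Lemma row_map_exact i (u : V i.+1) :
  row_map u = 0 <-> exists v : V i.+2, u = row_map v.
Proof.
case: F_res => _ _ _ _ /(_ i (\row_j u j)) ex; split.
  move=> u0; have /ex[v vE] : (\row_j u j) *m diff F i = 0.
    by rewrite row_mapE u0; apply/rowP => l; rewrite !mxE ffunE.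
  exists [ffun j => v 0 j]; apply/ffunP => j.
  have /rowP/(_ j) := vE; rewrite !mxE ffunE => ->.
  by apply: eq_bigr => l _; rewrite ffunE.
case=> v vE; have /ex : exists v : 'rV_(rank F i.+2), \row_j u j = v *m diff F i.+1.
  by exists (\row_j v j); rewrite row_mapE vE.
rewrite row_mapE => /rowP E; apply/ffunP => l.
by have := E l; rewrite !mxE => ->; rewrite ffunE.
Qed.

(** The component of degree [k] of the [i]-th module of the resolution. *)
Definition strand i k (u : V i) :=
  forall j m, m \in msupp (u j) -> (mdeg m + shift F i j)%N = k.

Arguments strand : clear implicits.

Lemma strand_linear i k : linear_pred (strand i k).
Proof.
split=> [j m|c u v su sv j m]; first by rewrite ffunE msupp0.
rewrite !ffunE => /msuppD_le; rewrite mem_cat => /orP[/msuppZ_le|].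
  exact: su.
exact: sv.
Qed.

Definition to_strand i k (u : V i) : V i :=
  [ffun j => mrestrict (fun m => mdeg m + shift F i j == k)%N (u j)].

Lemma to_strandP i k u : strand i k (to_strand k u).
Proof. by move=> j m; rewrite ffunE msupp_mrestrict => /andP[/eqP]. Qed.

Lemma to_strand_id i k u : strand i k u -> to_strand k u = u.
Proof.
move=> su; apply/ffunP => j; rewrite ffunE mrestrict_id // => m.
by move/su => ->.
Qed.

Lemma to_strand_row_map i k (u : V i.+1) :
  to_strand k (row_map u) = row_map (to_strand k u).
Proof.
case: F_res => _ hom _ _ _; apply/ffunP => l; rewrite !ffunE mrestrict_sum.
by apply: eq_bigr => j _; rewrite ffunE (@mrestrictM _ _ _ (shift F i.+1 j)) // => m /hom.
Qed.

Definition strand_dim i k : nat :=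
  \sum_(j < rank F i) #|[set m : 'X_{1..n < k.+1} | mdeg m + shift F i j == k]|%N.

(** A basis consists of the monomials of the right degree in each coordinate. *)
Lemma strand_has_dim i k : has_dim (strand i k) (strand_dim i k).
Proof.
pose T := {x : 'I_(rank F i) * 'X_{1..n < k.+1} | (mdeg x.2 + shift F i x.1 == k)%N}.
pose b (x : T) : V i :=
  [ffun j => if j == (val x).1 then 'X_[(val x).2] else 0].
have bE (c : T -> K) j : (\sum_x c x *: b x) j =
    \sum_(x : T | (val x).1 == j) c x *: 'X_[(val x).2].
  rewrite sum_ffunE [RHS]big_mkcond; apply: eq_bigr => x _.
  by rewrite !ffunE eq_sym; case: ifP => _; rewrite ?scaler0.
have coefE (c : T -> K) (x : T) :
    ((\sum_y c y *: b y) (val x).1)@_(val x).2 = c x.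
  rewrite bE raddf_sum /= (bigD1 x) //= mcoeffZ mcoeffX eqxx mulr1.
  rewrite big1 ?addr0 // => y /andP[/eqP y1 yx]; rewrite mcoeffZ mcoeffX.
  case: eqP => [y2|]; last by rewrite mulr0.
  case/eqP: yx; apply: val_inj; apply: injective_projections => //.
  exact: val_inj.
exists T, b; split.
- rewrite /strand_dim card_sig -sum1_card.
  rewrite (eq_bigl (fun x : 'I_(rank F i) * 'X_{1..n < k.+1} =>
     xpredT x.1 && (mdeg x.2 + shift F i x.1 == k)%N)) //.
  rewrite -(pair_big_dep xpredT
     (fun j (m : 'X_{1..n < k.+1}) => mdeg m + shift F i j == k)%N (fun _ _ => 1%N)) /=.
  by apply: eq_bigr => j _; rewrite sum1dep_card.
- move=> x j m; rewrite ffunE; case: eqP => [->|_]; last by rewrite msupp0.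
  by rewrite msuppX inE => /eqP ->; apply/eqP/(valP x).
- by move=> c E x; rewrite -(coefE c x) E ffunE mcoeff0.
move=> u su; exists (fun x : T => (u (val x).1)@_(val x).2).
apply/eqP; rewrite subr_eq0; apply/eqP/ffunP => j; apply/mpolyP => m.
have [mu|mu] := boolP (m \in msupp (u j)).
  have mk := su _ _ mu.
  have mb : (mdeg m < k.+1)%N by rewrite ltnS -mk leq_addr.
  have xP : (mdeg (BMultinom mb) + shift F i j == k)%N by rewrite /= mk.
  pose x : T := Sub (j, BMultinom mb) xP.
  by rewrite (coefE _ x).
rewrite (memN_msupp_eq0 mu) bE raddf_sum /= big1 // => x /eqP xj.
rewrite mcoeffZ mcoeffX; case: eqP => [E|]; last by rewrite mulr0.
by rewrite xj E (memN_msupp_eq0 mu) mul0r.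
Qed.

Definition strand_image i k (w : V i) := exists2 u, strand i.+1 k u & w = row_map u.

Arguments strand_image : clear implicits.

(** Exactness identifies each kernel with the next image, so consecutive image
    dimensions add up to the dimension of a strand. *)
Lemma strand_image_dims k : exists r : nat -> nat,
  (forall i, has_dim (strand_image i k) (r i)) /\
  (forall i, (r i + r i.+1)%N = strand_dim i.+1 k).
Proof.
have dims i : exists r, has_dim (strand_image i k) r.
  have [a [b [_ hb _]]] := rank_nullity (@row_map i) (strand_linear i.+1 k)
    (strand_has_dim i.+1 k).
  by exists b.
have [r rP] := boolp.choice dims; exists r; split=> // i.
have [a [b [ha hb <-]]] := rank_nullity (@row_map i) (strand_linear i.+1 k)
    (strand_has_dim i.+1 k).
rewrite (has_dim_uniq hb (rP i)) addnC; congr (_ + _)%N.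
apply: has_dim_uniq (rP i.+1) _; apply: eq_has_dim ha => u; split.
  case=> su /row_map_exact[v uv]; exists (to_strand k v); first exact: to_strandP.
  by rewrite -to_strand_row_map -uv to_strand_id.
case=> v sv ->; split; last by apply/row_map_exact; exists v.
by rewrite -(to_strand_id sv) -to_strand_row_map; exact: to_strandP.
Qed.

(** A basis of [S_k] modulo [I_k] and a basis of [I_k], the image of the first
    differential, make up a basis of [S_k]. *)
Lemma graded_dim_strand k h r : is_graded_dim I k h ->
  has_dim (strand_image 0 k) r -> (h + r)%N = strand_dim 0 k.
Proof.
case: F_res => -[rk0 sh0] _ _ Iim _ [b [bhom bfree bspan]] [T [w [<- wW wf ws]]].
have [I0 _ Ilin] : idealr_closed I by case: I_graded.
pose j0 : 'I_(rank F 0) := cast_ord (esym rk0) ord0.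
have jE (j : 'I_(rank F 0)) : j = j0.
  have : (j < 1)%N by rewrite -rk0 ltn_ord.
  by rewrite ltnS leqn0 => /eqP j00; apply: val_inj.
pose cst p : V 0 := [ffun => p].
have cstE (u : V 0) : u = cst (u j0) by apply/ffunP => j; rewrite ffunE (jE j).
have imP u : strand_image 0 k u <-> strand 0 k u /\ u j0 \in I.
  split.
    case=> v sv ->; split.
      by rewrite -(to_strand_id sv) -to_strand_row_map; exact: to_strandP.
    apply/Iim; exists (\row_j v j); rewrite row_mapE; apply/rowP => l.
    by rewrite !mxE (jE l).
  case=> su /Iim[v vE]; exists (to_strand k [ffun j => v 0 j]).
    exact: to_strandP.
  rewrite -to_strand_row_map -[LHS](to_strand_id su); congr to_strand.
  apply/ffunP => l; rewrite (jE l) ffunE.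
  have /rowP/(_ j0) := vE; rewrite !mxE => <-.
  by apply: eq_bigr => j _; rewrite ffunE.
pose c (x : 'I_h + T) : V 0 := match x with inl i => cst (b i) | inr t => w t end.
apply: has_dim_uniq _ (strand_has_dim 0 k).
exists ('I_h + T)%type, c; split.
- by rewrite card_sum card_ord.
- case=> [i|t] /=; last by case/imP: (wW t).
  by move=> j m; rewrite ffunE sh0 addn0; have /dhomogP := bhom i; apply.
- move=> a; rewrite big_sumType /= => E.
  have E0 : \sum_i a (inl i) *: b i = - (\sum_t a (inr t) *: w t) j0.
    have /ffunP/(_ j0) := E; rewrite !ffunE => /eqP; rewrite addr_eq0 => /eqP <-.
    by rewrite sum_ffunE; apply: eq_bigr => i _; rewrite !ffunE.
  have wI : - (\sum_t a (inr t) *: w t) j0 \in I.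
    rewrite -[- _]addr0 -mulN1r; apply: (Ilin) => //; rewrite sum_ffunE.
    apply: (big_ind (fun p => p \in I)) => [|x y xI yI|t _] //.
      by have := Ilin 1 x y xI yI; rewrite mul1r.
    rewrite ffunE -mul_mpolyC -[_ * _]addr0; apply: (Ilin) => //.
    by case/imP: (wW t).
  have a0 : forall i, a (inl i) = 0 by apply: bfree; rewrite E0.
  case=> [//|t]; move: t; apply: wf.
  rewrite big1 ?add0r // in E => i _.
  by rewrite a0 scale0r.
move=> u su.
have uh : u j0 \is k.-homog.
  by apply/dhomogP => m /su; rewrite sh0 addn0.
have [a aI] := bspan _ uh.
pose v := u - cst (\sum_i a i *: b i).
have vim : strand_image 0 k v.
  apply/imP; split; last by rewrite !ffunE.
  have [s0 sD] := strand_linear 0 k.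
  rewrite /v addrC -scaleN1r; apply: sD => // j m; rewrite ffunE sh0 addn0.
  have : \sum_i a i *: b i \is k.-homog by rewrite rpred_sum // => i _; exact: dhomogZ.
  by move/dhomogP; apply.
have [d dE] := ws _ vim.
exists (fun x => match x with inl i => a i | inr t => d t end).
rewrite big_sumType /= opprD addrA -[RHS]dE; congr (_ - _ - _).
apply/ffunP => j; rewrite sum_ffunE ffunE.
by apply: eq_bigr => i _; rewrite !ffunE.
Qed.

(** The alternating sum telescopes, because the image dimensions vanish beyond the
    length of the resolution. *)
Lemma hilbert_function_strands s k h : resolution_length F s ->
  is_graded_dim I k h ->
  h%:R = \sum_(i < s.+1) (-1) ^+ i * (strand_dim i k)%:R :> rat.
Proof.
move=> len hdim; have [r [rP rD]] := strand_image_dims k.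
have E t : h%:R = \sum_(i < t.+1) (-1) ^+ i * (strand_dim i k)%:R
    + (-1) ^+ t.+1 * (r t)%:R :> rat.
  elim: t => [|t ->].
    rewrite big_ord1 -(graded_dim_strand hdim (rP 0%N)) natrD; ring.
  by rewrite [in RHS]big_ord_recr /= -rD natrD !exprS; ring.
rewrite (E s); suff -> : r s = 0%N by rewrite mulr0 addr0.
have rk : rank F s.+1 = 0%N.
  by apply/eqP; rewrite -leqn0 leqNgt len ltnn.
have := rD s; rewrite /strand_dim big1 => [/eqP|[j lj]].
  by rewrite addn_eq0 => /andP[/eqP].
by suff : (j < 0)%N by []; rewrite -rk.
Qed.

End Strands.

(** * Hilbert series *)

(** The number of monomials of degree [k] in [m] variables; as a function of [k],
    the coefficients of [(1-t)^-m]. *)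
Definition multiset_count (m k : nat) : nat :=
  if m is m'.+1 then 'C(m' + k, m') else (k == 0)%N.

Lemma card_mdeg n N k : (k < N)%N ->
  #|[set m : 'X_{1..n < N} | mdeg m == k]| = multiset_count n k.
Proof.
move=> kN; case: n => [|n] /=.
  case: N kN => // N _; case: k => [|k] /=.
    apply/eqP; rewrite eqn_leq; apply/andP; split; last first.
      by apply/card_gt0P; exists bm0; rewrite inE /= mdeg0.
    apply/card_le1P => x _ y; rewrite !inE.
    have -> : y = x by apply: val_inj; rewrite [LHS]nvar0_mnmE [RHS]nvar0_mnmE.
    by rewrite eqxx nvar0_mnmE mdeg0.
  apply/eqP; rewrite cards_eq0 -subset0; apply/subsetP => x.
  by rewrite !inE nvar0_mnmE mdeg0.
rewrite -card_ord_partitions.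
pose f (m : 'X_{1..n.+1 < N}) : n.+1.-tuple 'I_k.+1 := [tuple inord (bmnm m i) | i < n.+1].
have mle (m : 'X_{1..n.+1 < N}) i : mdeg m == k -> (bmnm m i < k.+1)%N.
  by move/eqP <-; rewrite ltnS mdegE (bigD1 i) //= leq_addr.
rewrite -(@card_in_imset _ _ f) => [|m1 m2]; last first.
  rewrite !inE => h1 h2 E; apply: val_inj; apply/mnmP => i /=.
  have := congr1 (fun t => val (tnth t i)) E.
  by rewrite !tnth_mktuple /= !inordK ?mle.
apply: eq_card => t; rewrite inE; apply/imsetP/eqP.
  case=> m; rewrite inE => mk ->; rewrite big_tuple -[RHS](eqP mk) mdegE.
  by apply: eq_bigr => i _; rewrite tnth_mktuple inordK ?mle.
rewrite big_tuple => tk; pose m0 := [multinom (tnth t i : nat) | i < n.+1].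
have m0k : mdeg m0 = k by rewrite mdegE -[RHS]tk; apply: eq_bigr => i _; rewrite mnmE.
have m0N : (mdeg m0 < N)%N by rewrite m0k.
exists (BMultinom m0N); first by rewrite inE /= m0k.
by apply: eq_from_tnth => i; rewrite tnth_mktuple /= mnmE inord_val.
Qed.

Lemma multiset_countS m k :
  multiset_count m.+1 k.+1 = (multiset_count m.+1 k + multiset_count m k.+1)%N.
Proof.
case: m => [|m] /=; first by rewrite !add0n !bin0.
by rewrite addnS binS addSnnS.
Qed.

Lemma multiset_count0 m : multiset_count m 0 = 1%N.
Proof. by case: m => //= m; rewrite addn0 binn. Qed.

Arguments multiset_count : simpl never.

(** The [k]-th coefficient of the product of [p] and the power series with
    coefficients [a]. *)
Definition series_mul (p : {poly rat}) (a : nat -> rat) (k : nat) : rat :=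
  \sum_(l < k.+1) p`_l * a (k - l)%N.

Lemma series_mulD p q a k :
  series_mul (p + q) a k = series_mul p a k + series_mul q a k.
Proof.
by rewrite -big_split; apply: eq_bigr => l _; rewrite coefD mulrDl.
Qed.

Lemma series_mulZ c p a k : series_mul (c *: p) a k = c * series_mul p a k.
Proof. by rewrite mulr_sumr; apply: eq_bigr => l _; rewrite coefZ mulrA. Qed.

Lemma series_mul_sum (T : Type) (r : seq T) (Q : T -> {poly rat}) a k :
  series_mul (\sum_(i <- r) Q i) a k = \sum_(i <- r) series_mul (Q i) a k.
Proof.
elim: r => [|x r IH]; last by rewrite !big_cons series_mulD IH.
by rewrite !big_nil /series_mul big1 // => l _; rewrite coef0 mul0r.
Qed.

Lemma series_mulXn d a k :
  series_mul 'X^d a k = if (d <= k)%N then a (k - d)%N else 0.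
Proof.
rewrite /series_mul; under eq_bigr => l _ do rewrite coefXn.
case: leqP => dk.
  rewrite -ltnS in dk; rewrite (bigD1 (Ordinal dk)) //= eqxx mul1r big1 ?addr0 // => l nl.
  suff /negPf -> : nat_of_ord l != d by rewrite mul0r.
  by apply: contra nl => /eqP ld; apply/eqP/val_inj.
by rewrite big1 // => l _; rewrite ltn_eqF ?mul0r // (leq_trans (ltn_ord l)).
Qed.

Lemma series_mulX p a k :
  series_mul ('X * p) a k = if k is k'.+1 then series_mul p a k' else 0.
Proof.
rewrite /series_mul big_ord_recl coefXM /= mul0r add0r.
by case: k => [|k]; [rewrite big_ord0 | apply: eq_bigr => l _; rewrite coefXM].
Qed.

Local Notation free_series m := (fun k => (multiset_count m k)%:R : rat).

(** [(1 - t) * (1 - t)^-(m+1) = (1 - t)^-m] is Pascal's rule. *)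
Lemma series_mul_diff p m k :
  series_mul ((1 - 'X) * p) (free_series m.+1) k = series_mul p (free_series m) k.
Proof.
rewrite mulrBl mul1r series_mulD -scaleN1r series_mulZ series_mulX.
case: k => [|k].
  by rewrite mulr0 addr0 /series_mul !big_ord1 !multiset_count0.
rewrite mulN1r /series_mul big_ord_recr [RHS]big_ord_recr /= !subnn !multiset_count0.
rewrite addrAC -sumrB; congr (_ + _); apply: eq_bigr => l _ /=.
have lk : (l <= k)%N by rewrite -ltnS ltn_ord.
by rewrite subSn // multiset_countS natrD; ring.
Qed.

Lemma series_mul_order c m p k :
  series_mul ((1 - 'X) ^+ c * p) (free_series (c + m)) k =
  series_mul p (free_series m) k.
Proof.
elim: c => [|c IH]; first by rewrite mul1r.
by rewrite exprS -mulrA series_mul_diff IH.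
Qed.

(** Partial sums of coefficients are the coefficients after division by [1 - t]. *)
Lemma series_mul_cumulative p m k :
  \sum_(j < k.+1) series_mul p (free_series m) j =
  series_mul p (free_series m.+1) k.
Proof.
elim: k => [|k IH].
  by rewrite big_ord1 /series_mul !big_ord1 !multiset_count0.
rewrite big_ord_recr /= IH -(series_mul_diff p m).
rewrite mulrBl mul1r series_mulD -[- ('X * p)]scaleN1r series_mulZ series_mulX.
by rewrite mulN1r addrCA subrr addr0.
Qed.

Lemma series_mul0 p k : series_mul p (free_series 0) k = p`_k.
Proof.
rewrite /series_mul big_ord_recr /= subnn mulr1 big1 ?add0r // => l _.
by rewrite /multiset_count subn_eq0 leqNgt ltn_ord mulr0.
Qed.

(** The coefficients of [h(t) / (1-t)^(m+1)] are eventually a polynomial in the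
    index: the summand ['X^l] of [h] contributes the binomial polynomial
    [C(k - l + m, m)], whose leading coefficient [1 / m!] does not depend on [l]. *)
Lemma series_mul_poly m (h : {poly rat}) : exists Q : {poly rat},
  [/\ (size Q <= m.+1)%N, Q`_m = (m`!%:R)^-1 * h.[1]
    & forall k, (size h <= k)%N ->
        series_mul h (free_series m.+1) k = Q.[k%:R]].
Proof.
pose B l : {poly rat} := \prod_(1 <= j < m.+1) ('X - (l%:R - j%:R)%:P).
have sB l : size (B l) = m.+1.
  rewrite /B -(big_map (fun j => l%:R - j%:R : rat) xpredT (fun a => 'X - a%:P)).
  by rewrite size_prod_XsubC size_map size_iota subn1.
have mB l : (B l)`_m = 1.
  have /eqP := monic_prod_XsubC (index_iota 1 m.+1) xpredT (fun j => l%:R - j%:R : rat).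
  by rewrite lead_coefE -/(B l) sB.
have vB (l k : nat) : (l <= k)%N -> (B l).[k%:R] = m`!%:R * 'C(m + (k - l), m)%:R.
  move=> lk; rewrite horner_prod -natrM mulnC bin_ffact ffact_prod.
  rewrite natr_prod big_add1 /= big_mkord (reindex_inj rev_ord_inj) /=.
  apply: eq_bigr => i _; rewrite !hornerE; have := ltn_ord i => im.
  have -> : (m + (k - l) - i)%N = (k - l + (m - i.+1).+1)%N by lia.
  by rewrite natrD natrB //; ring.
exists ((m`!%:R)^-1 *: \sum_(l < size h) h`_l *: B l).
have fm : m`!%:R != 0 :> rat by rewrite pnatr_eq0 -lt0n fact_gt0.
split.
- apply: leq_trans (size_scale_leq _ _) _.
  apply: (leq_trans (size_sum _ _ _)); apply/bigmax_leqP => l _.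
  by apply: leq_trans (size_scale_leq _ _) _; rewrite sB.
- rewrite coefZ coef_sum horner_coef; congr (_ * _); apply: eq_bigr => l _.
  by rewrite coefZ mB expr1n.
move=> k hk; rewrite hornerZ horner_sum /series_mul.
rewrite (big_ord_widen k.+1 (fun l => (h`_l *: B l).[k%:R])) ?(leqW hk) //.
rewrite mulr_sumr [RHS]big_mkcond /=; apply: eq_bigr => l _.
case: ifP => [lh|/negbT]; last by rewrite -leqNgt => lh; rewrite nth_default ?mul0r.
have lk : (l <= k)%N by rewrite -ltnS ltn_ord.
by rewrite hornerZ vB //; field.
Qed.

(** Dividing the bound by [k^(d-1)] keeps [`|Q`_d| * k] bounded as [k] grows. *)
Lemma poly_growth (Q : {poly rat}) d a N (C : rat) : (size Q <= d.+1)%N -> (a < d)%N ->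
  (forall k, (N <= k)%N -> `|Q.[k%:R]| <= C * (k.+1%:R) ^+ a) -> Q`_d = 0.
Proof.
move=> sQ ad bQ; apply/eqP; apply: contraT => Qd.
pose c := C * 2 ^+ a + \sum_(i < d) `|Q`_i|.
have key k : (N < k)%N -> `|Q`_d| * k%:R <= c.
  move=> Nk; have k0 : 0 < k%:R :> rat by rewrite ltr0n; lia.
  have k1 : 1 <= k%:R :> rat by rewrite ler1n; lia.
  have C0 : 0 <= C.
    have := bQ _ (ltnW Nk); move/(le_trans (normr_ge0 _)).
    by rewrite pmulr_lge0 // exprn_gt0 // ltr0n.
  have d0 : (0 < d)%N by lia.
  rewrite -(ler_pM2r (exprn_gt0 d.-1 k0)) -mulrA -exprS prednK //.
  have E : Q.[k%:R] = \sum_(i < d) Q`_i * k%:R ^+ i + Q`_d * k%:R ^+ d.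
    by rewrite (horner_coef_wide _ sQ) big_ord_recr.
  have -> : `|Q`_d| * k%:R ^+ d = `|Q.[k%:R] - \sum_(i < d) Q`_i * k%:R ^+ i|.
    by rewrite E addrAC subrr add0r normrM (ger0_norm (exprn_ge0 _ (ltW k0))).
  apply: le_trans (ler_normB _ _) _; rewrite mulrDl; apply: lerD.
    apply: le_trans (bQ _ (ltnW Nk)) _; rewrite -mulrA ler_wpM2l //.
    apply: (@le_trans _ _ (2 ^+ a * k%:R ^+ a)).
      rewrite -exprMn lerXn2r ?nnegrE //; first by rewrite mulr_ge0 // ltW.
      by rewrite -natrM ler_nat; lia.
    by rewrite ler_wpM2l ?exprn_ge0 // ler_weXn2l //; lia.
  apply: le_trans (ler_norm_sum _ _ _) _; rewrite mulr_suml; apply: ler_sum => i _.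
  rewrite normrM ler_wpM2l // ger0_norm ?exprn_ge0 ?(ltW k0) //.
  by rewrite ler_weXn2l //; have := ltn_ord i; lia.
have Q0 : 0 < `|Q`_d| by rewrite normr_gt0.
have c0 : 0 <= c / `|Q`_d|.
  apply: divr_ge0 => //; apply: le_trans (key N.+1 _) => //.
  by rewrite mulr_ge0.
have := archi_boundP c0; set b := Num.bound _ => cb.
have := key (maxn N.+1 b); rewrite leq_max leqnn => /(_ isT).
rewrite mulrC -ler_pdivlMr // => /le_lt_trans/(_ cb).
by rewrite ltr_nat ltnNge leq_maxr.
Qed.

(** If [p] has only [c < s] factors [1 - t], then the coefficients of
    [p / (1-t)^(n+1)] are eventually a polynomial of degree [n - c > n - s]. *)
Lemma growth_order (n s : nat) (p : {poly rat}) (C : rat) : (s <= n)%N ->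
  (forall k, 0 <= series_mul p (free_series n.+1) k <= C * (k.+1%:R) ^+ (n - s)) ->
  exists h, p = (1 - 'X) ^+ s * h.
Proof.
move=> sn bound.
suff H c : (c <= s)%N -> exists h, p = (1 - 'X) ^+ c * h by exact: H.
elim: c => [|c IH] cs; first by exists p; rewrite mul1r.
have [h pE] := IH (ltnW cs).
have [Q [sQ Qd Qk]] := series_mul_poly (n - c) h.
have : Q`_(n - c) = 0.
  apply: (@poly_growth _ _ (n - s) (size h) C) => //; first lia.
  move=> k hk; rewrite -Qk // -(series_mul_order c) -pE.
  have -> : (c + (n - c).+1 = n.+1)%N by lia.
  by have /andP[H0 H1] := bound k; rewrite ger0_norm.
rewrite Qd => /eqP; rewrite mulf_eq0 invr_eq0 pnatr_eq0 eqn0Ngt fact_gt0 /= => h1.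
have /factor_theorem[g gE] : root h 1 by [].
exists (- g); rewrite pE gE exprSr; ring.
Qed.

(** For [s < n] the Hilbert polynomial has degree [n - s - 1] and leading
    coefficient [h(1) / (n-s-1)!]; for [s = n] the Hilbert function is the
    coefficient sequence of [h], and its sum is [h(1)]. *)
Lemma series_multiplicity (n s : nat) (h P : {poly rat}) (H : nat -> nat) N :
  (s <= n)%N -> h.[1] != 0 ->
  (forall k, (H k)%:R = series_mul ((1 - 'X) ^+ s * h) (free_series n) k) ->
  (forall k, (N <= k)%N -> (H k)%:R = P.[k%:R]) ->
  (if P == 0 then (\sum_(k < N) H k)%N%:R
   else ((size P).-1)`!%:R * lead_coef P) = h.[1].
Proof.
move=> sn h1 HE PE.
have Hh k : (H k)%:R = series_mul h (free_series (n - s)) k.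
  by rewrite HE -[in LHS](subnKC sn) series_mul_order.
have eqP0 (Q : {poly rat}) N' : (forall k, (N' <= k)%N -> Q.[k%:R] = 0) -> Q = 0.
  move=> Q0; apply/eqP; apply: contraT => nQ.
  (* more roots than the size allows *)
  pose rs := [seq (k%:R : rat) | k <- iota N' (size Q)].
  have : (size rs < size Q)%N.
    apply: max_poly_roots => //.
      by apply/allP => x /mapP[k]; rewrite mem_iota => /andP[kN _] ->; apply/eqP/Q0.
    by rewrite map_inj_uniq ?iota_uniq // => x y /eqP; rewrite eqr_nat => /eqP.
  by rewrite size_map size_iota ltnn.
case E: (n - s)%N => [|m]; rewrite E in Hh.
  have P0 : P = 0.
    apply: (eqP0 _ (maxn N (size h))) => k; rewrite geq_max => /andP[kN kh].
    by rewrite -PE // Hh series_mul0 nth_default.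
  rewrite P0 eqxx natr_sum.
  under eq_bigr => k _ do rewrite Hh series_mul0.
  have sh : (size h <= N)%N.
    apply/leq_sizeP => k kN; have := PE k kN.
    by rewrite P0 horner0 Hh series_mul0.
  rewrite (horner_coef_wide _ sh); apply: eq_bigr => k _.
  by rewrite expr1n mulr1.
have [Q [sQ Qd Qk]] := series_mul_poly m h.
have PQ : P = Q.
  apply/eqP; rewrite -subr_eq0; apply/eqP.
  apply: (eqP0 _ (maxn N (size h))) => k; rewrite geq_max => /andP[kN kh].
  by rewrite !hornerE -PE // Hh Qk // subrr.
have fm : m`!%:R != 0 :> rat by rewrite pnatr_eq0 -lt0n fact_gt0.
have Qm : Q`_m != 0 by rewrite Qd mulf_neq0 ?invr_eq0.
have szQ : size Q = m.+1.
  apply/eqP; rewrite eqn_leq sQ ltnNge.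
  by apply: contra Qm => le; rewrite nth_default.
by rewrite PQ -size_poly_eq0 szQ /= lead_coefE szQ Qd mulrA divff // mul1r.
Qed.

(** * Growth of quotients and chains of primes *)

Section Growth.

Variables (K : fieldType) (n : nat).
Local Notation S := {mpoly K[n]}.
Implicit Types (I J P Q : {pred S}) (A : {set 'I_n}).

(** The polynomials of degree at most [k] span a space of dimension [O(k^a)]
    modulo [J].  Bounding the independent families directly makes sense for any
    set [J]. *)
Definition growth_le J a := exists C : nat, forall k (T : finType) (v : T -> S),
  (forall i, msize (v i) <= k.+1)%N -> free_modulo (fun p => p \in J) v ->
  (#|T| <= C * k.+1 ^ a)%N.

Definition supported A (p : S) :=
  forall m, m \in msupp p -> forall i, i \notin A -> m i = 0%N.

(** The variables in [A] are algebraically independent modulo [J]. *)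
Definition independent J A := forall p, p \in J -> supported A p -> p = 0.

Lemma ideal_linear J : idealr_closed J -> linear_pred (fun p : S => p \in J).
Proof.
by case=> J0 _ JD; split=> // c u v uJ vJ; rewrite -mul_mpolyC; apply: JD.
Qed.

Lemma free_modulo_sum J (T T' : finType) (v : T -> S) (w : T' -> S) :
  (forall (c : T -> K) (d : T' -> K),
     \sum_i c i *: v i + \sum_j d j *: w j \in J ->
     (forall i, c i = 0) /\ (forall j, d j = 0)) ->
  free_modulo (fun p => p \in J)
    (fun x : T + T' => match x with inl i => v i | inr j => w j end).
Proof.
move=> h c; rewrite big_sumType /= => /h[c0 d0].
by case.
Qed.

Lemma monomials_card k : (#|{: 'X_{1..n < k.+1}}| <= k.+1 ^ n)%N.
Proof.
pose f (m : 'X_{1..n < k.+1}) : {ffun 'I_n -> 'I_k.+1} := [ffun i => inord (bmnm m i)].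
have mle (m : 'X_{1..n < k.+1}) i : (bmnm m i < k.+1)%N.
  by apply: leq_ltn_trans (bmdeg m); rewrite mdegE (bigD1 i) //= leq_addr.
rewrite -[X in (_ <= X ^ n)%N](card_ord k.+1) -[X in (_ <= _ ^ X)%N](card_ord n) -card_ffun.
apply: (leq_card f) => m1 m2 E; apply: val_inj; apply/mnmP => i /=.
by have /ffunP/(_ i)/(congr1 val) := E; rewrite /= !ffunE /= !inordK ?mle.
Qed.

Lemma growth_le_full J : 0 \in J -> growth_le J n.
Proof.
move=> J0; exists 1%N => k T v vk vfree; rewrite mul1n.
apply: leq_trans (monomials_card k).
have vfree0 : free_modulo (eq^~ 0) v by move=> c E; apply: vfree; rewrite E.
apply: (free_card_le (w := fun m : 'X_{1..n < k.+1} => 'X_[m]) (@linear_pred0 _ _) vfree0).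
by move=> i; exists (fun m : 'X_{1..n < k.+1} => (v i)@_m); rewrite -mpolywE ?subrr.
Qed.

(** Take for [w] the products [f ^+ j * v i] with [j < r].  A relation between them
    modulo [Q] is one modulo [P], so its part without [f] vanishes, and the rest
    can be divided by [f] since [Q] is prime. *)
Lemma free_modulo_tower Q P f e k (T : finType) (v : T -> S) r :
  prime_ideal Q -> idealr_closed P -> {subset Q <= P} -> f \in P -> f \notin Q ->
  (msize f <= e.+1)%N -> (forall i, msize (v i) <= k.+1)%N ->
  free_modulo (fun p => p \in P) v ->
  exists (T' : finType) (w : T' -> S),
    [/\ #|T'| = (r * #|T|)%N, forall i, (msize (w i) <= (k + r * e).+1)%N
      & free_modulo (fun p => p \in Q) w].
Proof.
move=> [Qid Qprime] Pid QP fP fQ fe vk vfree.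
elim: r => [|r [T' [w [cT wk wfree]]]].
  by exists void, (fun _ => 0); split; rewrite ?card_void.
exists (T' + T)%type, (fun x => match x with inl i => f * w i | inr i => v i end).
split.
- by rewrite card_sum cT mulSn addnC.
- case=> i; last by apply: leq_trans (vk i) _; rewrite ltnS leq_addr.
  have [->|w0] := eqVneq (w i) 0; first by rewrite mulr0 msize0.
  have f0 : f != 0 by apply: contra fQ => /eqP ->; case: Qid.
  rewrite msizeM // mulSn; move: (wk i) fe.
  by move: (msize (w i)) (msize f) (r * e)%N => x y z; lia.
apply: free_modulo_sum => c d cdQ.
have E : \sum_i c i *: (f * w i) = f * \sum_i c i *: w i.
  by rewrite mulr_sumr; apply: eq_bigr => i _; rewrite scalerAr.
have d0 : forall j, d j = 0.
  apply: vfree; case: Pid => P0 _ PD.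
  have fwP : f * \sum_i c i *: w i \in P.
    by have := PD (\sum_i c i *: w i) f 0 fP P0; rewrite addr0 mulrC.
  have := PD (-1) _ _ fwP (QP _ cdQ).
  by rewrite E mulN1r addKr.
split=> //; apply: wfree.
have : f * \sum_i c i *: w i \in Q.
  by move: cdQ; rewrite E [X in _ + X]big1 ?addr0 // => i _; rewrite d0 scale0r.
by move/Qprime; rewrite (negPf fQ).
Qed.

(** With [r = k + 1] the families of the previous lemma are [k + 1] times as large
    while their degrees grow by a constant factor only. *)
Lemma growth_le_prime_step Q P a :
  prime_ideal Q -> idealr_closed P -> strict_subideal Q P ->
  growth_le Q a -> (0 < a)%N /\ growth_le P a.-1.
Proof.
move=> Qprime Pid [QP [f fP fQ]] [C CQ].
pose e := (msize f).-1; have fe : (msize f <= e.+1)%N by rewrite /e; lia.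
case: a CQ => [|a] CQ; last split=> //.
  have free1 : free_modulo (fun p => p \in P) (fun _ : unit => 1 : S).
    move=> c; rewrite (big_pred1 tt) => [cP|[]] //; case=> //.
    apply/eqP; apply: contraT => c0; case: Pid => P0 /negP P1 PD; case: P1.
    have := PD (c tt)^-1%:MP _ 0 cP P0.
    by rewrite addr0 mul_mpolyC scalerA mulVf // scale1r.
  have [|T [w [cT wk wfree]]] := free_modulo_tower C.+1 (k := 0%N) Qprime Pid QP fP fQ fe _ free1.
    by move=> i; rewrite msize1.
  by have := CQ _ _ _ wk wfree; rewrite cT card_unit; lia.
exists (C * e.+1 ^ a.+1)%N => k T v vk vfree.
have [T' [w [cT wk wfree]]] := free_modulo_tower k.+1 Qprime Pid QP fP fQ fe vk vfree.
have := CQ _ _ _ wk wfree; rewrite cT.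
have -> : ((k + k.+1 * e).+1 = e.+1 * k.+1)%N by lia.
rewrite expnMn [X in (_ * (_ * X))%N]expnS => le.
rewrite -(leq_pmul2l (ltn0Sn k)); apply: leq_trans le _.
by rewrite /= !mulnA leq_mul2r -[(k.+1 * C)%N]mulnC [(C * k.+1 * _)%N]mulnAC leqnn orbT.
Qed.

Lemma prime_chain_growth l (C : nat -> {pred S}) :
  prime_chain l C -> (l <= n)%N /\ growth_le (C l) (n - l).
Proof.
case=> Cprime Cstrict.
suff H i : (i <= l)%N -> (i <= n)%N /\ growth_le (C i) (n - i) by exact: H.
elim: i => [|i IH] il.
  split=> //; rewrite subn0; apply: growth_le_full.
  by have [[]] := Cprime 0%N il.
have [le_in gi] := IH (ltnW il).
have [Ci _] := Cprime _ il.
have [] := growth_le_prime_step (Cprime _ (ltnW il)) Ci (Cstrict _ il) gi.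
by rewrite subn_gt0 subnS.
Qed.

(** There are [(q + 1)^#|A|] monomials in the variables of [A] with exponents at
    most [q], and their degrees are at most [n * q]. *)
Lemma independent_growth J A a : independent J A -> growth_le J a -> (#|A| <= a)%N.
Proof.
move=> indA [C CJ]; rewrite leqNgt; apply/negP => aA.
(* chosen so that [C * (n * q + 1)^a < (q + 1)^(a + 1)] *)
pose q := (C * n.+1 ^ a)%N.
pose T := {ffun {i | i \in A} -> 'I_q.+1}.
pose mon (f : T) := [multinom (if insub i is Some x then f x : nat else 0%N) | i < n].
have mon_inj : injective mon.
  move=> f g E; apply/ffunP => x; apply: val_inj.
  have /mnmP/(_ (val x)) := E; rewrite !mnmE insubT ?(valP x) // => px.
  by have -> : Sub (val x) px = x by apply: val_inj.
have := CJ (n * q)%N T (fun f => 'X_[mon f]) _ _.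
have -> : #|T| = (q.+1 ^ #|A|)%N by rewrite card_ffun card_ord card_sig.
move=> H; have {H} : (q.+1 ^ #|A| <= C * (n * q).+1 ^ a)%N.
  apply: H => [f|c].
    rewrite msizeX ltnS mdegE -[n in (_ <= n * _)%N]card_ord -sum_nat_const.
    by apply: leq_sum => i _; rewrite mnmE; case: insub => // x; rewrite -ltnS.
  move/indA => E f; have supp : supported A (\sum_i c i *: 'X_[mon i]).
    move=> m /msupp_sum_le /flatten_mapP[g _ /msuppZ_le]; rewrite msuppX inE => /eqP -> i iA.
    by rewrite mnmE insubN.
  have := congr1 (mcoeff (mon f)) (E supp); rewrite mcoeff0 raddf_sum /=.
  rewrite (bigD1 f) //= mcoeffZ mcoeffX eqxx mulr1 big1 ?addr0 // => g gf.
  by rewrite mcoeffZ mcoeffX (inj_eq mon_inj) (negPf gf) mulr0.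
apply/negP; rewrite -ltnNge.
have le1 : (C * (n * q).+1 ^ a <= q * q.+1 ^ a)%N.
  rewrite {2}/q -mulnA -expnMn leq_mul2l; apply/orP; right.
  by case: (a) => // b; rewrite leq_exp2r //; lia.
apply: leq_ltn_trans le1 _.
apply: (@leq_trans (q.+1 ^ a.+1)%N); last by rewrite leq_pexp2l.
by rewrite expnS ltn_pmul2r ?expn_gt0.
Qed.

End Growth.

Section Dimension.

Variables (K : fieldType) (n : nat).
Local Notation S := {mpoly K[n]}.
Implicit Types (I J P Q : {pred S}) (A : {set 'I_n}).

Lemma supportedM A (p q : S) : supported A p -> supported A q -> supported A (p * q).
Proof.
move=> sp sq m /msuppM_le /allpairsP[[m1 m2] /= [m1p m2q ->]] i iA.
by rewrite mnmDE (sp _ m1p) // (sq _ m2q).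
Qed.

(** An ideal maximal among those disjoint from the multiplicative set of nonzero
    polynomials in the variables of [A] is prime. *)
Lemma prime_over_independent I A : idealr_closed I -> independent I A ->
  exists P : {pred S}, [/\ prime_ideal P, {subset I <= P} & independent P A].
Proof.
move=> Iid Iind.
pose ideal (X : S -> Prop) := X 0 /\ forall a u v, X u -> X v -> X (a * u + v).
pose good (X : S -> Prop) := [/\ ideal X, forall p, p \in I -> X p
  & forall p, X p -> supported A p -> p = 0].
(* The empty set is admitted as the union of the empty chain. *)
pose PP : classical_sets.set (classical_sets.set S) :=
  fun X => (forall p, ~ X p) \/ good X.
have gI : good (fun p => p \in I) by case: Iid => I0 I1 ID; split=> //; split.
have [F FPP Ftot|X [PX Xmax]] := @classical_sets.Zorn_bigcup S PP.
  have [[X FX gX]|none] := boolp.EM (exists2 X, F X & good X); last first.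
    left=> p [X FX Xp]; case: (FPP _ FX) => [/(_ p)//|gX].
    by case: none; exists X.
  right; case: gX => -[X0 XD] IX Xind; split.
  - split; first by exists X.
    move=> a u v [Y FY Yu] [Z FZ Zv].
    have [W [FW Wu Wv]] : exists W, [/\ F W, W u & W v].
      by have [/(_ _ Yu)|/(_ _ Zv)] := Ftot _ _ FY FZ; [exists Z | exists Y].
    exists W => //; case: (FPP _ FW) => [/(_ u)//|[[_ WD] _ _]].
    exact: WD.
  - by move=> p pI; exists X => //; exact: IX.
  - move=> p [Y FY Yp]; case: (FPP _ FY) => [/(_ p)//|[_ _ Yind]].
    exact: Yind.
have gX : good X.
  case: PX => // Xempty; case: (Xmax (fun p => p \in I)); last by right.
  split=> [p /Xempty//|]; case: Iid => I0 _ _ /(_ 0 I0).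
  exact: Xempty.
case: (gX) => -[X0 XD] IX Xind.
have one_supp : supported A (1 : S).
  by move=> m; rewrite msupp1 inE => /eqP -> i _; rewrite mnm0E.
have ext f : ~ X f -> exists u g, [/\ X u, u + g * f != 0 & supported A (u + g * f)].
  move=> nXf; pose Y p := exists u g, X u /\ p = u + g * f.
  apply: boolp.contrapT => nex; apply: (Xmax Y).
    split=> [p Xp|sub]; first by exists p, 0; rewrite mul0r addr0.
    by apply: nXf; apply: sub; exists 0, 1; rewrite add0r mul1r.
  right; split.
  - split; first by exists 0, 0; rewrite mul0r addr0.
    move=> a _ _ [u [g [Xu ->]]] [u' [g' [Xu' ->]]].
    by exists (a * u + u'), (a * g + g'); split; [exact: XD | ring].
  - by move=> p /IX Xp; exists p, 0; rewrite mul0r addr0.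
  - move=> p [u [g [Xu pE]]] sp; apply/eqP; apply: contraT => p0.
    by case: nex; exists u, g; rewrite -pE.
exists (fun p => boolp.asbool (X p)); split.
- split.
    split; first exact/boolp.asboolP.
      by apply/boolp.asboolP => /Xind/(_ one_supp)/eqP; rewrite oner_eq0.
    by move=> a u v /boolp.asboolP Xu /boolp.asboolP Xv; apply/boolp.asboolP/XD.
  move=> f g /boolp.asboolP Xfg; apply/orP; apply: boolp.contrapT => nfg.
  have [|u [a [Xu ne1 s1]]] := ext f.
    by move=> Xf; apply: nfg; left; apply/boolp.asboolP.
  have [|v [b [Xv ne2 s2]]] := ext g.
    by move=> Xg; apply: nfg; right; apply/boolp.asboolP.
  have : (u + a * f) * (v + b * g) = 0.
    apply: Xind (supportedM s1 s2).
    have -> : (u + a * f) * (v + b * g) =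
      (v + b * g) * u + (a * f * v + (a * b * (f * g) + 0)) by ring.
    by apply: (XD) => //; apply: (XD) => //; apply: (XD).
  by move/eqP; rewrite mulf_eq0 (negPf ne1) (negPf ne2).
- by move=> p /IX Xp; apply/boolp.asboolP.
- by move=> p /boolp.asboolP; apply: Xind.
Qed.

Lemma height_independent I s A : idealr_closed I -> height_ge I s ->
  independent I A -> (s + #|A| <= n)%N.
Proof.
move=> Iid Is Iind; have [P [Pp IP Pind]] := prime_over_independent Iid Iind.
have [C [Cchain CP]] := Is P Pp IP.
have [sn gs] := prime_chain_growth Cchain.
have : (#|A| <= n - s)%N.
  by apply: independent_growth gs => p; rewrite CP; apply: Pind.
lia.
Qed.

(** Division by the elements of [J]: a leading monomial which is not standard is
    cancelled by a multiple of some [f] in [J], and the remainder is smaller. *)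
Lemma standard_monomials_span J (std : pred 'X_{1..n}) k : idealr_closed J ->
  (forall m, ~~ std m -> exists f, [/\ f \in J, f != 0 & (mlead f <= m)%MM]) ->
  forall p : S, (msize p <= k.+1)%N ->
  spans_modulo (fun q => q \in J)
    (fun x : {m : 'X_{1..n < k.+1} | std m} => 'X_[val x]) p.
Proof.
move=> Jid nstd; have linJ := ideal_linear Jid; have [J0 _ JD] := Jid.
elim/mleadrect => p IH pk; have [->|p0] := eqVneq p 0.
  exists (fun _ => 0); rewrite big1 ?subrr // => x _.
  by rewrite scale0r.
set m := mlead p.
have mk : (mdeg m < k.+1)%N by rewrite /m mlead_deg.
have [g [lg cg gspan]] : exists g : S, [/\ mlead g = m, g@_m = 1
    & spans_modulo (fun q => q \in J)
    (fun x : {m : 'X_{1..n < k.+1} | std m} => 'X_[val x]) g].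
  have [sm|/nstd[f [fJ f0 fm]]] := boolP (std m).
    exists 'X_[m]; rewrite mleadXm mcoeffX eqxx; split=> //.
    pose x : {m : 'X_{1..n < k.+1} | std m} := Sub (BMultinom mk) sm.
    exists (fun y => (y == x)%:R); rewrite (bigD1 x) //= eqxx scale1r.
    rewrite big1 ?addr0 ?subrr // => y /negPf ->.
    by rewrite scale0r.
  have lf : mlead ('X_[m - mlead f] * f) = m.
    by rewrite mleadM ?mleadXm ?submK // -msize_poly_eq0 msizeX.
  exists ((mleadc f)^-1 *: ('X_[m - mlead f] * f)).
  have cf : mleadc f != 0 by rewrite mleadc_eq0.
  split; first by rewrite mleadZ ?invr_eq0.
    have := mleadcM 'X_[m - mlead f] f.
    rewrite mleadXm submK // mcoeffZ => ->.
    by rewrite mcoeffX eqxx mul1r mulVf.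
  exists (fun _ => 0); rewrite big1 ?subr0 => [|x _]; last by rewrite scale0r.
  by have := JD ((mleadc f)^-1 *: 'X_[m - mlead f]) f 0 fJ J0; rewrite addr0 scalerAl.
pose q := p - mleadc p *: g.
have qm : q@_m = 0 by rewrite mcoeffB mcoeffZ cg mulr1 subrr.
have [c cJ] : spans_modulo (fun q => q \in J)
    (fun x : {m : 'X_{1..n < k.+1} | std m} => 'X_[val x]) q.
  have [->|q0] := eqVneq q 0.
    exists (fun _ => 0); rewrite big1 ?subrr // => x _.
    by rewrite scale0r.
  have lq : (mlead q < m)%O.
    rewrite lt_neqAle; apply/andP; split.
      by apply: contraNneq q0 => E; rewrite -mleadc_eq0 E qm.
    apply: le_trans (mleadB_le _ _) _; rewrite leUx lexx /=.
    by apply: le_trans (mleadZ_le _ _) _; rewrite lg.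
  apply: IH => //; rewrite -(mlead_deg q0) ltnS.
  by apply: leq_trans (lemc_mdeg (ltW lq)) _; rewrite -ltnS.
have [d dJ] := gspan.
exists (fun x => mleadc p * d x + c x).
have -> : p - \sum_x (mleadc p * d x + c x) *: 'X_[val x] =
    mleadc p *: (g - \sum_x d x *: 'X_[val x]) + (q - \sum_x c x *: 'X_[val x]).
  under eq_bigr => x _ do rewrite scalerDl -scalerA.
  rewrite big_split /= -scaler_sumr /q scalerBr.
  by move: (mleadc p *: g) (mleadc p *: _) (\sum_x _) => x y z; ring.
by case: linJ => _; apply.
Qed.

(** Such a monomial is determined by its exponents truncated at [N], which show
    where the exponents are large, together with the list of the at most [a]
    large ones. *)
Lemma card_few_large_exponents N a k :
  (#|[pred m : 'X_{1..n < k.+1} | (#|[set i | N <= bmnm m i]| <= a)%N]|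
     <= N.+1 ^ n * k.+1 ^ a)%N.
Proof.
pose B (m : 'X_{1..n}) := [set i | (N <= m i)%N].
pose f (m : 'X_{1..n < k.+1}) : {ffun 'I_n -> 'I_N.+1} * {ffun 'I_a -> 'I_k.+1} :=
  ([ffun i => inord (minn (bmnm m i) N)],
   [ffun j : 'I_a => inord (nth 0%N [seq bmnm m i | i <- enum (B m)] j)]).
have mle (m : 'X_{1..n < k.+1}) i : (bmnm m i < k.+1)%N.
  by apply: leq_ltn_trans (bmdeg m); rewrite mdegE (bigD1 i) //= leq_addr.
have f1 (m : 'X_{1..n < k.+1}) i : ((f m).1 i : nat) = minn (bmnm m i) N.
  by rewrite ffunE inordK // ltnS geq_minr.
have inj_f : {in [pred m : 'X_{1..n < k.+1} | (#|B m| <= a)%N] &, injective f}.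
  move=> m1 m2; rewrite !inE => h1 h2 E.
  have EB : B m1 = B m2.
    apply/setP => i; rewrite !inE.
    have := f1 m1 i; rewrite E f1; lia.
  apply: val_inj; apply/mnmP => i /=.
  have [iB|iB] := boolP (i \in B m1); last first.
    have iB2 : i \notin B m2 by rewrite -EB.
    move: iB iB2; have := f1 m1 i; rewrite E f1 !inE; lia.
  have ia : (index i (enum (B m1)) < a)%N.
    by apply: leq_trans h1; rewrite cardE index_mem mem_enum.
  have g (m : 'X_{1..n < k.+1}) : B m = B m1 -> ((f m).2 (Ordinal ia) : nat) = bmnm m i.
    move=> Bm; rewrite ffunE /= Bm (nth_map i) ?index_mem ?mem_enum //.
    by rewrite nth_index ?mem_enum // inordK.
  by rewrite -g // E g.
rewrite -(card_in_imset inj_f); apply: leq_trans (max_card _) _.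
by rewrite card_prod !card_ffun !card_ord.
Qed.

(** Every set of more than [a] variables carries a relation in [J].  If [N] exceeds
    the degrees of these relations, a monomial with more than [a] exponents at
    least [N] is divisible by one of their leading monomials, and the other
    monomials of degree at most [k] are [O(k^a)] in number. *)
Lemma growth_le_independent J a : idealr_closed J ->
  (forall A, independent J A -> (#|A| <= a)%N) -> growth_le J a.
Proof.
move=> Jid indJ.
have dep A : exists f : S, (a < #|A|)%N -> [/\ f \in J, f != 0 & supported A f].
  case: (leqP #|A| a) => [le|lt]; first by exists 0.
  apply: boolp.contrapT => nex; have : (#|A| <= a)%N; last lia.
  apply: indJ => p pJ ps; apply/eqP; apply: contraT => p0.
  by case: nex; exists p.
have [f fP] := boolp.choice dep.
pose N := (\sum_A msize (f A))%N.
pose std (m : 'X_{1..n}) := (#|[set i | N <= m i]| <= a)%N.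
have nstd m : ~~ std m -> exists f, [/\ f \in J, f != 0 & (mlead f <= m)%MM].
  rewrite -ltnNge => /fP; set A := [set _ | _] => -[fJ f0 fA].
  exists (f A); split=> //; apply/mnm_lepP => j.
  have lead := mlead_supp f0.
  have [jA|jA] := boolP (j \in A); last by rewrite (fA _ lead).
  move: (jA); rewrite inE; apply: leq_trans; apply: ltnW.
  have -> : N = (msize (f A) + \sum_(B | B != A) msize (f B))%N by rewrite /N (bigD1 A).
  apply: leq_trans (leq_addr _ _); rewrite -(mlead_deg f0) ltnS mdegE (bigD1 j) //=.
  by rewrite leq_addr.
exists (N.+1 ^ n)%N => k T v vk vfree.
have lin := ideal_linear Jid.
apply: leq_trans (free_card_le lin vfree
  (fun i => standard_monomials_span Jid nstd (vk i))) _.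
by rewrite card_sig; exact: card_few_large_exponents.
Qed.

(** Bases of the graded pieces of degree at most [k] are jointly independent,
    because [J] contains the components of its elements. *)
Lemma hilbert_sum_growth J (H : nat -> nat) a :
  graded_ideal J -> (forall k, is_graded_dim J k (H k)) -> growth_le J a ->
  exists C : nat, forall k, (\sum_(j < k.+1) H j <= C * k.+1 ^ a)%N.
Proof.
case=> Jid Jgr Hdim [C CJ]; exists C => k; have [J0 _ JD] := Jid.
suff [T [v [<- vk vfree]]] : exists (T : finType) (v : T -> S),
    [/\ #|T| = (\sum_(j < k.+1) H j)%N, forall i, (msize (v i) <= k.+1)%N
      & free_modulo (fun p => p \in J) v] by exact: CJ.
have homog_size d (p : S) : p \is d.-homog -> (msize p <= d.+1)%N.
  by move/dhomogP => hp; rewrite msizeE; apply/bigmax_leqP_seq => m mp _; rewrite ltnS hp.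
elim: k => [|k [T [v [cT vk vfree]]]].
  have [b [bhom bfree _]] := Hdim 0%N.
  exists 'I_(H 0%N), b; split=> [|i|]; first by rewrite card_ord big_ord1.
    exact: homog_size.
  exact: bfree.
have [b [bhom bfree _]] := Hdim k.+1.
exists (T + 'I_(H k.+1))%type, (fun x => match x with inl i => v i | inr i => b i end).
split.
- by rewrite card_sum cT card_ord [RHS]big_ord_recr.
- by case=> i; [apply: leq_trans (vk i) _ | exact: homog_size].
apply: free_modulo_sum => c d cdJ.
have d0 : forall i, d i = 0.
  apply: bfree; have := Jgr _ k.+1 cdJ; rewrite raddfD /=.
  have -> : pihomog mdeg k.+1 (\sum_i c i *: v i) = 0.
    rewrite raddf_sum big1 //= => i _; rewrite linearZ /= pihomog_mrestrict.
    suff -> : mrestrict (fun m => mdeg m == k.+1) (v i) = 0 by rewrite scaler0.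
    apply/mpolyP => m; rewrite mcoeff_mrestrict mcoeff0; case: eqP => // mk.
    by rewrite memN_msupp_eq0 // msize_mdeg_ge // mk.
  rewrite add0r raddf_sum /=.
  under eq_bigr => i _ do rewrite linearZ /= pihomog_dE //.
  by [].
split=> //; apply: vfree; move: cdJ.
by rewrite [X in _ + X]big1 ?addr0 // => i _; rewrite d0 scale0r.
Qed.

End Dimension.

(** * Regular sequences in sets of slow growth *)

Section WeaklyRegular.

Variable R : comNzRingType.
Implicit Types (f : nat -> R) (g : R).

Definition in_span f j g := exists a : nat -> R, g = \sum_(i < j) a i * f i.

(** Weakly: the quotient by the whole sequence may be zero. *)
Definition weakly_regular f c :=
  forall j g, (j < c)%N -> in_span f j (g * f j) -> in_span f j g.

Lemma in_span0 f j : in_span f j 0.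
Proof. by exists (fun _ => 0); rewrite big1 // => i _; rewrite mul0r. Qed.

Lemma in_spanMD f j a u v : in_span f j u -> in_span f j v -> in_span f j (a * u + v).
Proof.
case=> x -> [y ->]; exists (fun i => a * x i + y i).
rewrite mulr_sumr -big_split; apply: eq_bigr => i _ /=.
by rewrite mulrDl mulrA.
Qed.

Lemma in_spanM f j a u : in_span f j u -> in_span f j (a * u).
Proof. by move=> hu; rewrite -[a * u]addr0; apply: in_spanMD => //; apply: in_span0. Qed.

Lemma in_spanD f j u v : in_span f j u -> in_span f j v -> in_span f j (u + v).
Proof. by move=> hu hv; rewrite -[u]mul1r; apply: in_spanMD. Qed.

Lemma in_spanB f j u v : in_span f j u -> in_span f j v -> in_span f j (u - v).
Proof. by move=> hu hv; rewrite -mulN1r addrC; apply: in_spanMD. Qed.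

Lemma in_span_sum f j (T : Type) (r : seq T) (F : T -> R) :
  (forall i, in_span f j (F i)) -> in_span f j (\sum_(i <- r) F i).
Proof.
move=> h; elim: r => [|x r IH]; first by rewrite big_nil; apply: in_span0.
by rewrite big_cons; apply: in_spanD.
Qed.

Lemma in_spanS f j g : in_span f j.+1 g -> exists y, in_span f j (g - y * f j).
Proof.
case=> a ->; exists (a j); exists a.
by rewrite big_ord_recr /= addrK.
Qed.

Lemma in_span_widen f j g : in_span f j g -> in_span f j.+1 g.
Proof.
case=> a ->; exists (fun i => if i == j then 0 else a i).
rewrite big_ord_recr /= eqxx mul0r addr0; apply: eq_bigr => i _.
by rewrite ltn_eqF.
Qed.

Lemma eq_in_span f f' j g : (forall i, (i < j)%N -> f i = f' i) ->
  in_span f j g -> in_span f' j g.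
Proof. by move=> E [a ->]; exists a; apply: eq_bigr => i _; rewrite E. Qed.

End WeaklyRegular.

Lemma in_span_morph (R R' : comNzRingType) (phi : R -> R') (f : nat -> R) j g :
  phi 0 = 0 -> {morph phi : x y / x + y} -> {morph phi : x y / x * y} ->
  in_span f j g -> in_span (phi \o f) j (phi g).
Proof.
move=> phi0 phiD phiM [a ->]; exists (phi \o a).
rewrite (big_morph phi phiD phi0).
by apply: eq_bigr => i _ /=; rewrite phiM.
Qed.

Section PolynomialExtension.

Variable R : comNzRingType.
Implicit Types (f : nat -> R) (g q : {poly R}).

Lemma in_span_polyC f j g :
  in_span (fun i => (f i)%:P) j g <-> forall l, in_span f j g`_l.
Proof.
split=> [[a ->] l|h].
  exists (fun i => (a i)`_l); rewrite coef_sum; apply: eq_bigr => i _.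
  by rewrite coefMC.
have [a aE] := boolp.choice h.
exists (fun i => \poly_(l < size g) a l i); apply/polyP => l.
rewrite coef_sum; case: (ltnP l (size g)) => hl.
  by rewrite aE; apply: eq_bigr => i _; rewrite coefMC coef_poly hl.
rewrite nth_default // big1 // => i _.
by rewrite coefMC coef_poly ltnNge hl mul0r.
Qed.

(** If [g * q] has coefficients in an ideal and the leading coefficient of [q] is
    invertible, then the leading coefficient of [g] lies in the ideal; remove it
    and repeat. *)
Lemma in_span_polyC_regular f j q d u g : (size q <= d.+1)%N -> u * q`_d = 1 ->
  in_span (fun i => (f i)%:P) j (g * q) -> in_span (fun i => (f i)%:P) j g.
Proof.
move=> sq uq; have [k] := ubnP (size g).
elim: k g => // k IH g; rewrite ltnS => sg gq.
have [->|g0] := eqVneq g 0; first exact: in_span0.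
have sg1 : (0 < size g)%N by rewrite size_poly_gt0.
pose e := (size g).-1; pose c := g`_e.
have cin : in_span f j c.
  have /in_span_polyC/(_ (e + d)%N) := gq.
  have -> : (g * q)`_(e + d) = c * q`_d.
    rewrite coefM; have ed : (e < (e + d).+1)%N by rewrite ltnS leq_addr.
    rewrite (bigD1 (Ordinal ed)) //= addKn big1 ?addr0 // => i ie.
    have : nat_of_ord i != e by apply: contra ie => /eqP ie; apply/eqP/val_inj.
    rewrite neq_ltn => /orP[lt|lt].
      by rewrite [q`__]nth_default ?mulr0 //; apply: leq_trans sq _; lia.
    by rewrite [g`__]nth_default ?mul0r // -(prednK sg1).
  by move/(in_spanM u); rewrite mulrCA uq mulr1.
have mon : in_span (fun i => (f i)%:P) j (c *: 'X^e).
  apply/in_span_polyC => l; rewrite coefZ mulrC.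
  exact: in_spanM.
have -> : g = (g - c *: 'X^e) + c *: 'X^e by rewrite subrK.
apply: in_spanD => //; apply: IH.
  apply: leq_trans sg; rewrite -(prednK sg1) ltnS -/e.
  apply/leq_sizeP => l le; rewrite coefB coefZ coefXn.
  case: (eqVneq l e) => [->|ne]; first by rewrite mulr1 subrr.
  by rewrite mulr0 subr0 nth_default // -(prednK sg1) ltn_neqAle eq_sym ne.
rewrite mulrBl; apply: in_spanB => //.
by rewrite mulrC; apply: in_spanM.
Qed.

(** Putting [q] last leaves its predecessors constant, so that their regularity can
    be checked coefficientwise. *)
Lemma weakly_regular_polyC f c q d u : (size q <= d.+1)%N -> u * q`_d = 1 ->
  weakly_regular f c ->
  weakly_regular (fun i => if (i < c)%N then (f i)%:P else q) c.+1.
Proof.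
move=> sq uq freg j g; rewrite ltnS leq_eqVlt => /orP[/eqP->|jc].
  rewrite ltnn => h; pose F i := (f i)%:P.
  have E i : (i < c)%N -> (if (i < c)%N then (f i)%:P else q) = F i by move=> ->.
  apply: (@eq_in_span _ F) => [i /E //|].
  by apply: (in_span_polyC_regular sq uq); apply: eq_in_span h.
rewrite jc => h; pose F i := (f i)%:P.
have E i : (i < j)%N -> (if (i < c)%N then (f i)%:P else q) = F i.
  by move=> ij; rewrite (ltn_trans ij jc).
apply: (@eq_in_span _ F) => [i /E //|].
have {}h : in_span F j (g * (f j)%:P) by apply: eq_in_span h.
apply/in_span_polyC => l; apply: freg => //.
by have /in_span_polyC/(_ l) := h; rewrite coefMC.
Qed.

End PolynomialExtension.

Lemma digits_inj n N (a b : 'I_n -> nat) :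
  (forall i, (a i < N)%N) -> (forall i, (b i < N)%N) ->
  (\sum_i a i * N ^ i = \sum_i b i * N ^ i)%N -> a =1 b.
Proof.
elim: n a b => [|n IH] a b aN bN; first by move=> _ [].
have N0 : (0 < N)%N by apply: leq_ltn_trans (aN ord0).
have E (c : 'I_n.+1 -> nat) :
    (\sum_i c i * N ^ i = (\sum_(i < n) c (lift ord0 i) * N ^ i) * N + c ord0)%N.
  rewrite big_ord_recl expn0 muln1 addnC big_distrl; congr (_ + _)%N.
  by apply: eq_bigr => i _; rewrite /= expnSr mulnA.
rewrite !E => eq_ab.
have ab0 : a ord0 = b ord0.
  by have := congr1 (modn^~ N) eq_ab; rewrite !modnMDl !modn_small.
move: eq_ab; rewrite ab0 => /addIn /eqP; rewrite eqn_pmul2r // => /eqP /IH IHab.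
move=> i; case: (unliftP ord0 i) => [j ->|-> //].
exact: IHab.
Qed.

Section Nagata.

Variables (K : fieldType) (n N : nat).
Hypothesis N_gt0 : (0 < N)%N.
Local Notation S := {mpoly K[n.+1]}.
Local Notation S' := {mpoly K[n]}.

(** Nagata's change of variables: [shear] replaces the variable [x_i] by
    [x_i + x_0 ^ (N ^ i)] for [i > 0] and regards the result as a polynomial in
    [x_0]; [unshear] is its inverse and [shear_inv] the restriction of the inverse
    to constants. *)
Definition shear_inv : S' -> S :=
  mmap (@mpolyC n.+1 K) (fun i => 'X_(lift ord0 i) - 'X_ord0 ^+ (N ^ i.+1)).

HB.instance Definition _ := GRing.RMorphism.on shear_inv.

Definition shear_var (j : 'I_n.+1) : {poly S'} :=
  if unlift ord0 j is Some i then ('X_i)%:P + 'X^(N ^ i.+1) else 'X.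

Definition shear : S -> {poly S'} :=
  mmap ((@polyC S') \o (@mpolyC n K)) shear_var.

HB.instance Definition _ := GRing.RMorphism.on shear.

Definition unshear : {poly S'} -> S := horner_eval 'X_ord0 \o map_poly shear_inv.

HB.instance Definition _ := GRing.RMorphism.on unshear.

Lemma mpoly_morph_ext (k : nat) (R : comNzRingType) (g h : {rmorphism {mpoly K[k]} -> R}) :
  (forall c, g c%:MP = h c%:MP) -> (forall i, g 'X_i = h 'X_i) -> g =1 h.
Proof.
move=> hC hX p; rewrite [p]mpolyE !raddf_sum; apply: eq_bigr => m _ /=.
rewrite -mul_mpolyC !rmorphM hC mpolyXE_id !rmorph_prod; congr (_ * _).
by apply: eq_bigr => i _; rewrite !rmorphXn hX.
Qed.

Lemma shear_shear_inv a : shear (shear_inv a) = a%:P.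
Proof.
apply: (@mpoly_morph_ext n _ (shear \o shear_inv) (@polyC S')) a => [c|i] /=.
  by rewrite /shear_inv mmapC /shear mmapC.
rewrite /shear_inv mmapX mmap1U rmorphB rmorphXn /= /shear !mmapX !mmap1U.
by rewrite /shear_var liftK unlift_none addrK.
Qed.

Lemma unshear_polyC a : unshear a%:P = shear_inv a.
Proof. by rewrite /unshear /= map_polyC /horner_eval hornerC. Qed.

Lemma unshear_shear p : unshear (shear p) = p.
Proof.
apply: (@mpoly_morph_ext n.+1 _ (unshear \o shear) idfun) p => [c|j] /=.
  by rewrite /shear mmapC /= unshear_polyC /shear_inv mmapC.
rewrite /shear mmapX mmap1U /shear_var; case: unliftP => [i ->|->].
  rewrite rmorphD rmorphXn /= unshear_polyC /shear_inv mmapX mmap1U.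
  by rewrite /unshear /= map_polyX /horner_eval hornerX subrK.
by rewrite /unshear /= map_polyX /horner_eval hornerX.
Qed.

Lemma shear0 : shear 0 = 0. Proof. exact: rmorph0. Qed.
Lemma shearD : {morph shear : x y / x + y}. Proof. exact: rmorphD. Qed.
Lemma shearM : {morph shear : x y / x * y}. Proof. exact: rmorphM. Qed.
Lemma unshear0 : unshear 0 = 0. Proof. exact: rmorph0. Qed.
Lemma unshearD : {morph unshear : x y / x + y}. Proof. exact: rmorphD. Qed.
Lemma unshearM : {morph unshear : x y / x * y}. Proof. exact: rmorphM. Qed.

Lemma msize_le_mul (k a b : nat) (p q : {mpoly K[k]}) :
  (msize p <= a.+1)%N -> (msize q <= b.+1)%N -> (msize (p * q) <= (a + b).+1)%N.
Proof.
have [->|p0] := eqVneq p 0; first by rewrite mul0r msize0.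
have [->|q0] := eqVneq q 0; first by rewrite mulr0 msize0.
by rewrite msizeM //; move: (msize p) (msize q) => x y; lia.
Qed.

Lemma msize_shear_inv p k : (msize p <= k.+1)%N ->
  (msize (shear_inv p) <= (k * N ^ n).+1)%N.
Proof.
move=> pk; rewrite /shear_inv /mmap.
apply: leq_trans (msize_sum _ _ _) _; apply/bigmax_leqP_seq => m mp _.
rewrite mul_mpolyC; apply: leq_trans (msizeZ_le _ _) _.
apply: (@leq_trans (mdeg m * N ^ n).+1); last first.
  rewrite ltnS leq_mul2r; apply/orP; right.
  by rewrite -ltnS; apply: leq_trans pk; apply: msize_mdeg_lt.
rewrite mdegE big_distrl /= /mmap1.
apply: (big_ind2 (fun (q : S) d => msize q <= d.+1)%N) => [|q d q' d'|i _].
- by rewrite msize1.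
- exact: msize_le_mul.
have Ni : (0 < N ^ n)%N by rewrite expn_gt0 N_gt0.
have varsize : (msize ('X_(lift ord0 i) - 'X_ord0 ^+ (N ^ i.+1) : S) <= (N ^ n).+1)%N.
  apply: leq_trans (msizeD_le _ _) _; rewrite msizeN mpolyXn !msizeX geq_max mdegMn !mdeg1.
  by rewrite mul1n !ltnS Ni leq_pexp2l.
elim: (m i) => [|e IH]; first by rewrite expr0 msize1.
by rewrite exprS mulSn; apply: msize_le_mul.
Qed.

Lemma growth_le_shear (J : {pred S}) a :
  growth_le J a -> growth_le [pred p | shear_inv p \in J] a.
Proof.
case=> C CJ; exists (C * (N ^ n) ^ a)%N => k T v vk vfree.
have /CJ H i : (msize (shear_inv (v i)) <= (k * N ^ n).+1)%N by apply: msize_shear_inv.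
apply: leq_trans (H _) _.
  move=> c cJ; apply: vfree; rewrite inE raddf_sum /=.
  suff E i : shear_inv (c i *: v i) = c i *: shear_inv (v i).
    by under eq_bigr => i _ do rewrite E.
  by rewrite -!mul_mpolyC rmorphM /= [in LHS]/shear_inv mmapC.
rewrite -mulnA leq_mul2l; apply/orP; right.
have Ni : (0 < N ^ n)%N by rewrite expn_gt0 N_gt0.
rewrite -expnMn; case: (a) => // b; rewrite leq_exp2r //.
by rewrite mulnS [(_ * k)%N]mulnC; lia.
Qed.

(** A monomial with exponents [m_i] becomes monic in [x_0], of degree
    [sum_i m_i N^i].  By uniqueness of the digits in base [N] these degrees are
    distinct, so the leading coefficient of [shear p] is a single coefficient of
    [p]. *)
Lemma shear_lead p : p != 0 -> (forall m, m \in msupp p -> forall i, (m i < N)%N) ->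
  exists d u, (size (shear p) <= d.+1)%N /\ u * (shear p)`_d = 1.
Proof.
move=> p0 pN; pose wt (m : 'X_{1..n.+1}) := (\sum_i m i * N ^ i)%N.
have wtP m : mmap1 shear_var m \is monic /\ size (mmap1 shear_var m) = (wt m).+1.
  pose P (q : {poly S'}) d := q \is monic /\ size q = d.+1.
  have PM q d q' d' : P q d -> P q' d' -> P (q * q') (d + d')%N.
    case=> mq sq [mq' sq']; split; first by rewrite monicMl.
    by rewrite size_monicM ?monic_neq0 // sq sq' addnS.
  have P1 : P 1 0%N by split; [exact: monic1 | rewrite size_poly1].
  apply: (big_ind2 P) => // i _.
  have Pvar : P (shear_var i) (N ^ i)%N.
    rewrite /shear_var; case: unliftP => [j ->|->]; last first.
      by split; rewrite ?monicX ?size_polyX ?expn0.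
    have sz : (size (('X_j)%:P : {poly S'}) < size ('X^(N ^ j.+1) : {poly S'}))%N.
      rewrite size_polyXn; apply: leq_ltn_trans (size_polyC_leq1 _) _.
      by rewrite ltnS expn_gt0 N_gt0.
    split; last by rewrite addrC size_polyDl // size_polyXn.
    by rewrite monicE addrC lead_coefDl // lead_coefXn.
  elim: (m i) => [//|e IH].
  by rewrite exprS mulSn; apply: PM.
have wt_inj m m' : m \in msupp p -> m' \in msupp p -> wt m = wt m' -> m = m'.
  by move=> mp mp' E; apply/mnmP; apply: (@digits_inj _ N) => // i; apply: pN.
have [m0 m0p m0max] : exists2 m0, m0 \in msupp p & forall m, m \in msupp p -> (wt m <= wt m0)%N.
  pose s := msupp p; have sE : (exists d, d \in map wt s).
    by exists (wt (mlead p)); apply: map_f; apply: mlead_supp.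
  have sB d : d \in map wt s -> (d <= \sum_(m <- s) wt m)%N.
    by case/mapP => m ms ->; rewrite (big_rem m) //= leq_addr.
  case: (ex_maxnP sE sB) => d /mapP[m0 m0s ->] dmax.
  by exists m0 => // m mp; apply: dmax; apply: map_f.
exists (wt m0), (p@_m0)^-1%:MP; split.
  rewrite /shear /mmap; apply: leq_trans (size_sum _ _ _) _.
  apply/bigmax_leqP_seq => m mp _ /=; rewrite mul_polyC.
  apply: leq_trans (size_scale_leq _ _) _.
  by have [_ ->] := wtP m; rewrite ltnS m0max.
rewrite /shear /mmap coef_sum (bigD1_seq m0) //= big_seq_cond big1 => [|m /andP[mp mm0]].
  have [/monicP mon sz] := wtP m0.
  rewrite coefCM; move: mon; rewrite lead_coefE sz => ->.
  by rewrite addr0 mulr1 -mpolyCM mulVf ?mpolyC1 // -mcoeff_msupp.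
have [_ sz] := wtP m; rewrite coefCM nth_default ?mulr0 // sz.
rewrite ltn_neqAle m0max // andbT.
by apply: contra mm0 => /eqP E; apply/eqP; apply: wt_inj.
Qed.

End Nagata.

(** A nonzero [p] in [J], which exists since the growth of [S/J] is smaller than
    that of [S], is monic in [x_0], up to a constant, after Nagata's change of
    variables.  The elements of [J] free of the new [x_0] form a set with the same
    growth bound in one variable fewer, and contain a regular sequence of length
    [c - 1] by induction; appending [p] to it gives one of length [c]. *)
Lemma slow_growth_regular (K : fieldType) (n : nat) (J : {pred {mpoly K[n]}}) c :
  (c <= n)%N -> growth_le J (n - c) ->
  exists f : nat -> {mpoly K[n]}, weakly_regular f c /\ forall j, (j < c)%N -> f j \in J.
Proof.
elim: n J c => [|n IH] J [|c]; try by move=> _ _; exists (fun _ => 0).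
  by [].
rewrite ltnS subSS => cn gJ.
have [p [pJ p0]] : exists p, p \in J /\ p != 0.
  apply: boolp.contrapT => nex.
  have ind : independent J setT.
    by move=> p pJ _; apply/eqP; apply: contraT => p0; case: nex; exists p.
  by have := independent_growth ind gJ; rewrite cardsT card_ord; lia.
pose N := (msize p).+1.
have pN m : m \in msupp p -> forall i, (m i < N)%N.
  move=> mp i; apply: ltnW; rewrite /N ltnS; apply: leq_trans (msize_mdeg_lt mp).
  by rewrite ltnS mdegE (bigD1 i) //= leq_addr.
have N0 : (0 < N)%N by [].
have [f [freg fJ]] := IH _ c cn (growth_le_shear N0 gJ).
have [d [u [sq uq]]] := shear_lead N0 p0 pN.
have Freg := weakly_regular_polyC sq uq freg.
set F := (fun i => if (i < c)%N then _ else _) in Freg.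
pose G i := if (i < c)%N then shear_inv N (f i) else p.
have GF i : shear N (G i) = F i.
  by rewrite /G /F; case: ifP => // _; rewrite shear_shear_inv.
exists G; split=> [j g jc gG|j jc]; last first.
  by rewrite /G; case: ifP => // jc'; apply: fJ.
have := in_span_morph (@shear0 K n N) (@shearD K n N) (@shearM K n N) gG.
rewrite shearM GF => gF.
have {gF} : in_span F j (shear N g * F j).
  by apply: eq_in_span gF => i _; exact: GF.
move/(Freg _ _ jc)/(in_span_morph (@unshear0 K n N) (@unshearD K n N) (@unshearM K n N)).
rewrite unshear_shear; apply: eq_in_span => i _ /=.
by rewrite -GF unshear_shear.
Qed.

(** * Acyclicity of the dual complex *)

Section DualComplex.

Variables (R : comNzRingType) (r : nat -> nat).
Variable D : forall i, 'M[R]_(r i.+1, r i).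
Hypothesis r0 : r 0%N = 1%N.
Hypothesis exact : forall i (u : 'rV[R]_(r i.+1)),
  u *m D i = 0 <-> exists v : 'rV[R]_(r i.+2), u = v *m D i.+1.

Lemma complexE i : D i.+1 *m D i = 0.
Proof.
apply/row_matrixP => l; rewrite row_mul row0.
by apply/exact; exists (delta_mx 0 l); rewrite rowE.
Qed.

Lemma exact_mx m i (A : 'M[R]_(m, r i.+1)) : A *m D i = 0 ->
  exists B : 'M[R]_(m, r i.+2), A = B *m D i.+1.
Proof.
move=> AD.
have H l : exists v : 'rV[R]_(r i.+2), row l A = v *m D i.+1.
  by apply/exact; rewrite -row_mul AD row0.
have [v vE] := boolp.choice H; exists (\matrix_l v l).
by apply/row_matrixP => l; rewrite row_mul rowK.
Qed.

Lemma homotopy0 (a : R) (u : 'rV[R]_(r 1%N)) : u *m D 0%N = const_mx a ->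
  exists h : 'M[R]_(r 0%N, r 1%N), h *m D 0%N = a%:M.
Proof.
move=> uE; exists (\matrix_(i, j) u 0 j); apply/matrixP => i l.
have /rowP/(_ l) := uE; rewrite !mxE => <-.
have -> : i = l.
  have ri (k : 'I_(r 0%N)) : nat_of_ord k = 0%N.
    have : (k < 1)%N by rewrite -r0 ltn_ord.
    by rewrite ltnS leqn0 => /eqP.
  by apply: val_inj; rewrite /= !ri.
by rewrite eqxx mulr1n; apply: eq_bigr => j _; rewrite mxE.
Qed.

(** Multiplication by an element of the resolved ideal is null homotopic. *)
Lemma homotopyS (a : R) (u : 'rV[R]_(r 1%N)) i : u *m D 0%N = const_mx a ->
  exists (h : 'M[R]_(r i, r i.+1)) (h' : 'M[R]_(r i.+1, r i.+2)),
    a%:M = h' *m D i.+1 + D i *m h.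
Proof.
move=> uE; elim: i => [|i [h [h' hE]]].
  have [h hE] := homotopy0 uE.
  have [|h' h'E] := @exact_mx _ 0%N (a%:M - D 0%N *m h).
    by rewrite mulmxBl -mulmxA hE mul_scalar_mx mul_mx_scalar subrr.
  by exists h, h'; rewrite -h'E subrK.
have [|h'' h''E] := @exact_mx _ i.+1 (a%:M - D i.+1 *m h').
  rewrite mulmxBl -mulmxA; have -> : h' *m D i.+1 = a%:M - D i *m h by rewrite hE addrK.
  by rewrite mulmxBr mulmxA complexE mul0mx subr0 mul_scalar_mx mul_mx_scalar subrr.
by exists h', h''; rewrite -h''E subrK.
Qed.

Variables (f : nat -> R) (c : nat).
Hypothesis freg : weakly_regular f c.
Hypothesis fI : forall j, (j < c)%N ->
  exists u : 'rV[R]_(r 1%N), u *m D 0%N = const_mx (f j).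

Let col_span m j (w : 'cV[R]_m) := forall l, in_span f j (w l 0).

Let col_spanM m m' j (A : 'M[R]_(m, m')) (w : 'cV[R]_m') :
  col_span j w -> col_span j (A *m w).
Proof. by move=> h l; rewrite mxE; apply: in_span_sum => k; apply: in_spanM. Qed.

Let col_spanD m j (w w' : 'cV[R]_m) :
  col_span j w -> col_span j w' -> col_span j (w + w').
Proof. by move=> h h' l; rewrite mxE; apply: in_spanD. Qed.

Let col_spanN m j (w : 'cV[R]_m) : col_span j w -> col_span j (- w).
Proof. by move=> h l; rewrite mxE -mulN1r; apply: in_spanM. Qed.

Let col_spanS m j (w : 'cV[R]_m) : col_span j.+1 w ->
  exists y : 'cV[R]_m, col_span j (w - f j *: y).
Proof.
move=> h; have [y yE] := boolp.choice (fun l => in_spanS (h l)).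
by exists (\col_l y l) => l; rewrite !mxE mulrC.
Qed.

Let col_span_reg m j (w : 'cV[R]_m) : (j < c)%N -> col_span j (f j *: w) -> col_span j w.
Proof. by move=> jc h l; apply: freg => //; have := h l; rewrite mxE mulrC. Qed.

(* Exactness of the dual complex at [i] modulo the first [j] elements; at [i = 0]
   it will be used with [z = 0]. *)
Let dual_cycle i j := forall w : 'cV[R]_(r i), col_span j (D i *m w) ->
  exists z : 'cV[R]_(r i), D i *m z = 0 /\ col_span j (w - z).

Let dual_cycle0 j : (j < c)%N -> dual_cycle 0%N j.
Proof.
move=> jc w hw; exists 0; rewrite mulmx0 subr0; split=> //.
have [u uE] := fI jc; have [h hE] := homotopy0 uE.
by apply: col_span_reg => //; rewrite -mul_scalar_mx -hE -mulmxA; apply: col_spanM.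
Qed.

(* For a cocycle [w] modulo the first [j] elements, the homotopy writes [f j *: w]
   as the coboundary of [h *m w], which is thus a cocycle modulo one more
   element.  Subtracting from it a genuine cocycle leaves a multiple [f j *: y],
   and [f j] can be cancelled in [f j *: w = f j *: (D i *m y)]. *)
Let dual_step i j : (j < c)%N -> dual_cycle i j.+1 ->
  forall w : 'cV[R]_(r i.+1), col_span j (D i.+1 *m w) ->
  exists y : 'cV[R]_(r i), col_span j (w - D i *m y).
Proof.
move=> jc IH w hw; have [u uE] := fI jc; have [h [h' hE]] := homotopyS i uE.
have fw : f j *: w = h' *m (D i.+1 *m w) + D i *m (h *m w).
  by rewrite -mul_scalar_mx hE mulmxDl !mulmxA.
have [|z [z0 hz]] := IH (h *m w).
  have -> : D i *m (h *m w) = f j *: w - h' *m (D i.+1 *m w) by rewrite fw addrAC subrr add0r.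
  apply: col_spanD.
    move=> l; rewrite mxE mulrC; apply: in_spanM.
    by exists (fun k => (k == j)%:R); rewrite big_ord_recr /= eqxx mul1r big1 ?add0r
      // => k _; rewrite ltn_eqF ?mul0r.
  by apply: col_spanN => l; apply: in_span_widen; apply: (col_spanM h' hw).
have [y hy] := col_spanS hz; exists y; apply: col_span_reg => //.
have -> : f j *: (w - D i *m y) =
    h' *m (D i.+1 *m w) + D i *m (h *m w - z - f j *: y).
  rewrite scalerBr fw !mulmxBr z0 subr0 -scalemxAr addrA.
  by [].
by apply: col_spanD; apply: col_spanM.
Qed.

Let dual_cycle_all i j : (i + j < c)%N -> dual_cycle i j.
Proof.
elim: i j => [|i IH] j ijc; first exact: dual_cycle0.
have jc : (j < c)%N by apply: leq_ltn_trans ijc; rewrite leq_addl.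
have ijc' : (i + j.+1 < c)%N by rewrite addnS.
move=> w hw; have [y hy] := dual_step jc (IH _ ijc') hw.
by exists (D i *m y); rewrite mulmxA complexE mul0mx.
Qed.

(** [Ext^i(R/I, R) = 0] for [i] smaller than the length of a regular sequence in
    [I], in the degrees [i > 0]. *)
Lemma dual_exact i (w : 'cV[R]_(r i.+1)) : (i.+1 < c)%N -> D i.+1 *m w = 0 ->
  exists y : 'cV[R]_(r i), w = D i *m y.
Proof.
move=> ic Dw.
have c0 : (0 < c)%N by apply: leq_trans ic.
have ic1 : (i + 1 < c)%N by rewrite addn1.
have [|y hy] := dual_step c0 (dual_cycle_all ic1) (w := w).
  by rewrite Dw => l; rewrite mxE; apply: in_span0.
exists y; apply/eqP; rewrite -subr_eq0; apply/eqP/colP => l.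
by have [a ->] := hy l; rewrite big_ord0 mxE.
Qed.

End DualComplex.

(** * Shifts of a minimal resolution *)

Lemma strand_dimE (K : fieldType) (n : nat) (F : graded_free_seq K n) i k : (strand_dim F i k)%:R =
  \sum_(j < rank F i)
    series_mul 'X^(shift F i j) (fun k => (multiset_count n k)%:R) k.
Proof.
rewrite natr_sum; apply: eq_bigr => j _; rewrite series_mulXn; case: leqP => dk.
  rewrite -(@card_mdeg n k.+1) ?ltnS ?leq_subr //; congr (_%:R).
  by apply: eq_card => m; rewrite !inE; apply/eqP/eqP; move: dk; lia.
rewrite (_ : [set _ | _] = set0) ?cards0 //; apply/setP => m; rewrite !inE.
by apply/eqP => E; move: dk; rewrite -E ltnNge leq_addl.
Qed.

Section Shifts.

Variables (K : fieldType) (n s : nat) (I : {pred {mpoly K[n]}}) (F : graded_free_seq K n).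
Hypothesis F_res : minimal_graded_resolution I F.
Hypothesis F_length : resolution_length F s.

Local Notation S := {mpoly K[n]}.

Let rank0 : rank F 0 = 1%N.
Proof. by case: F_res => -[]. Qed.

Let rank_gt0 i : (i <= s)%N -> (0 < rank F i)%N.
Proof. by rewrite F_length. Qed.

(** Entries of such products lie in the irrelevant ideal. *)
Lemma mulmx_diff_neq1 p i (A : 'M[S]_(p, rank F i.+1)) a b :
  (A *m diff F i) a b != 1.
Proof.
have [_ _ mini _ _] := F_res; apply/eqP => /(congr1 (mcoeff 0%MM)).
rewrite mxE raddf_sum mcoeff1 eqxx big1 => [/esym/eqP|k _]; first by rewrite oner_eq0.
by rewrite /= rmorphM /= (eqP (mini _ _ _)) mulr0.
Qed.

Lemma diff_mulmx_neq1 q i (B : 'M[S]_(rank F i, q)) a b :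
  (diff F i *m B) a b != 1.
Proof.
have [_ _ mini _ _] := F_res; apply/eqP => /(congr1 (mcoeff 0%MM)).
rewrite mxE raddf_sum mcoeff1 eqxx big1 => [/esym/eqP|k _]; first by rewrite oner_eq0.
by rewrite /= rmorphM /= (eqP (mini _ _ _)) mul0r.
Qed.

Lemma shift_diff_neq0 i j k : diff F i j k != 0 -> (shift F i k < shift F i.+1 j)%N.
Proof.
have [_ hom mini _ _] := F_res.
rewrite -msupp_eq0; case E: (msupp _) => [//|m t] _.
have ms : m \in msupp (diff F i j k) by rewrite E mem_head.
rewrite -(hom _ _ _ _ ms) -[X in (X < _)%N]add0n ltn_add2r lt0n mdeg_eq0.
by apply: contraTneq ms => ->; rewrite -mcoeff_eq0; exact: mini.
Qed.

(** If the [j]-th row of a differential vanished, the basis vector [j] would be a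
    cycle, hence a boundary, against minimality. *)
Lemma shift_above i j : exists k, (shift F i k < shift F i.+1 j)%N.
Proof.
have [_ _ _ _ ex] := F_res.
have [/existsP[k nz]|/existsPn row0] := boolP [exists k, diff F i j k != 0].
  by exists k; exact: shift_diff_neq0.
have /ex[v vE] : delta_mx 0 j *m diff F i = 0 :> 'rV_(rank F i).
  by rewrite -rowE; apply/rowP => k; rewrite !mxE; apply/eqP; have := row0 k; rewrite negbK.
by have := mulmx_diff_neq1 v 0 j; rewrite -vE mxE !eqxx.
Qed.

Lemma min_shift_le i j : (min_shift F i <= shift F i j)%N.
Proof.
rewrite /min_shift; have : j \in index_enum 'I_(rank F i) by rewrite mem_index_enum.
elim: (index_enum _) => // x t IH; rewrite inE big_cons => /orP[/eqP ->|/IH le].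
  exact: geq_minl.
by apply: leq_trans le; exact: geq_minr.
Qed.

Lemma max_shift_ge i j : (shift F i j <= max_shift F i)%N.
Proof. by rewrite /max_shift (leq_bigmax j). Qed.

Lemma max_shift_attained i : (i <= s)%N -> exists j, max_shift F i = shift F i j.
Proof.
move/rank_gt0 => r0; have := @bigop.eq_bigmax _ (shift F i).
by rewrite card_ord => /(_ r0)[j jE]; exists j.
Qed.

Lemma min_shift_attained i : (i <= s)%N -> exists j, min_shift F i = shift F i j.
Proof.
move/max_shift_attained => [j0 E].
rewrite /min_shift E; elim: (index_enum _) => [|x t [j IH]]; first by exists j0; rewrite big_nil.
rewrite big_cons IH; case: (leqP (shift F i x) (shift F i j)) => _; first by exists x.
by exists j.
Qed.

Lemma min_le_max_shift i : (i <= s)%N -> (min_shift F i <= max_shift F i)%N.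
Proof. by move/max_shift_attained => [j ->]; exact: min_shift_le. Qed.

Lemma min_shift_ltS i : (i < s)%N -> (min_shift F i < min_shift F i.+1)%N.
Proof.
move/min_shift_attained => [j ->]; have [k lt] := shift_above j.
by apply: leq_ltn_trans lt; exact: min_shift_le.
Qed.

Hypothesis growth : growth_le I (n - s).
Hypothesis sn : (s <= n)%N.

(** If the column of a basis vector [j] of maximal degree vanished, [j] would be a
    cocycle of the dual complex, hence a coboundary, against minimality.  A nonzero
    entry in that column leads to a generator of larger degree in the next step. *)
Lemma max_shift_ltS i : (0 < i < s)%N -> (max_shift F i < max_shift F i.+1)%N.
Proof.
case: i => // i /= is1; have [_ _ _ Iim ex] := F_res.
have [j ->] := max_shift_attained (ltnW is1).
have [/existsP[k nz]|/existsPn col0] := boolP [exists k, diff F i.+1 k j != 0].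
  by apply: leq_trans (max_shift_ge k); exact: shift_diff_neq0.
have [f [freg fI]] := slow_growth_regular sn growth.
have fI' l : (l < s)%N -> exists u : 'rV_(rank F 1), u *m diff F 0%N = const_mx (f l).
  by move/fI/Iim.
have [|y yE] := dual_exact rank0 ex freg fI' (w := delta_mx j 0) is1.
  by rewrite -colE; apply/colP => k; rewrite !mxE; apply/eqP; have := col0 k; rewrite negbK.
by have := diff_mulmx_neq1 y j 0; rewrite -yE mxE !eqxx.
Qed.

End Shifts.

Theorem theorem3p4 (K : fieldType) (n s : nat) (I : {pred {mpoly K[n]}})
    (F : graded_free_seq K n) (e : rat)
    (I_graded : graded_ideal I)
    (I_irrelevant : {subset I <= irrelevant_ideal K n})
    (I_codim : is_height I s)
    (R_CM : cohen_macaulay I)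
    (F_res : minimal_graded_resolution I F)
    (F_length : resolution_length F s)
    (F_quasi_pure : quasi_pure F s)
    (e_mult : is_multiplicity I e) :
  let lower : rat := (s`!%:R)^-1 * \prod_(1 <= i < s.+1) (min_shift F i)%:R in
  let upper : rat := (s`!%:R)^-1 * \prod_(1 <= i < s.+1) (max_shift F i)%:R in
  lower <= e <= upper /\ (e = lower \/ e = upper -> pure F s).
Proof.
move=> lower upper.
have I_ideal : idealr_closed I by case: I_graded.
have indep_dim A : independent I A -> (s + #|A| <= n)%N.
  by apply: height_independent => //; case: I_codim.
have sn : (s <= n)%N.
  rewrite -[s]addn0 -(cards0 'I_n); apply: indep_dim => p /I_irrelevant p0 supp.
  apply/mpolyP => m; rewrite mcoeff0; apply/eqP; rewrite mcoeff_eq0.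
  apply/negP => mp; have m0 : m = 0%MM.
    by apply/mnmP => i; rewrite mnm0E; apply: supp => //; rewrite inE.
  by move: mp; rewrite m0 mcoeff_msupp (eqP p0) eqxx.
have growth : growth_le I (n - s).
  by apply: growth_le_independent => // A /indep_dim; lia.
have [[rank0 shift0] _ _ _ _] := F_res.
have [H [P [N [Hdim HP eE]]]] := e_mult.
pose kp : {poly rat} := \sum_(i < s.+1) (-1) ^+ i *: \sum_(j < rank F i) 'X^(shift F i j).
have HE k : (H k)%:R = series_mul kp (fun k => (multiset_count n k)%:R) k.
  rewrite (hilbert_function_strands I_graded F_res F_length (Hdim k)) series_mul_sum.
  apply: eq_bigr => i _; rewrite series_mulZ series_mul_sum; congr (_ * _).
  exact: strand_dimE.
have [h kE] : exists h, kp = (1 - 'X) ^+ s * h.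
  have [C HC] := hilbert_sum_growth I_graded Hdim growth.
  apply: (@growth_order n s _ C%:R) => // k.
  rewrite -series_mul_cumulative.
  under eq_bigr => j _ do rewrite -HE.
  by rewrite -natr_sum ler0n -natrX -natrM ler_nat HC.
have md i j : (1 <= i <= s)%N -> (min_shift F i <= shift F i j <= max_shift F i)%N.
  by move=> _; rewrite min_shift_le max_shift_ge.
have mM i : (1 <= i <= s)%N -> (min_shift F i <= max_shift F i)%N.
  by case/andP => _; exact: (min_le_max_shift F_length).
have lo := node_lower rank0 shift0 kE md F_quasi_pure mM.
have hi := node_upper rank0 shift0 kE md F_quasi_pure mM.
have min_lt i : (i < s)%N -> (min_shift F i < min_shift F i.+1)%N.
  exact: (min_shift_ltS F_res F_length).
have min_pos i : (1 <= i <= s)%N -> (0 < min_shift F i)%N.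
  by case: i => // i /andP[_ /min_lt]; apply: leq_ltn_trans.
have s_pos : 0 < s`!%:R :> rat by rewrite ltr0n fact_gt0.
have h1 : h.[1] != 0.
  have : 0 < s`!%:R * h.[1].
    apply: lt_le_trans lo; rewrite big_nat prodr_gt0 // => i hi'.
    by rewrite ltr0n min_pos // -ltnS.
  by rewrite pmulr_rgt0 // => /gt_eqF ->.
have eh : e = h.[1].
  by rewrite eE; apply: (series_multiplicity sn h1) HP => k; rewrite HE kE.
have lowerE : (e = lower) <-> s`!%:R * h.[1] = \prod_(1 <= i < s.+1) (min_shift F i)%:R.
  rewrite eh /lower; split=> [->|<-]; first by rewrite mulVKf ?gt_eqF.
  by rewrite mulKf ?gt_eqF.
have upperE : (e = upper) <-> s`!%:R * h.[1] = \prod_(1 <= i < s.+1) (max_shift F i)%:R.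
  rewrite eh /upper; split=> [->|<-]; first by rewrite mulVKf ?gt_eqF.
  by rewrite mulKf ?gt_eqF.
split.
  by rewrite eh /lower /upper ler_pdivrMl // ler_pdivlMl // lo hi.
have min_mono a b : (a <= b <= s)%N -> (min_shift F a <= min_shift F b)%N.
  elim: b => [|b IH]; first by rewrite leqn0 => /andP[/eqP ->].
  rewrite leq_eqVlt => /andP[/orP[/eqP ->//|ab] bs].
  by apply: leq_trans (IH _) (ltnW (min_lt _ _)); lia.
have max_lt i : (0 < i < s)%N -> (max_shift F i < max_shift F i.+1)%N.
  exact: (max_shift_ltS F_res F_length growth sn).
have max_mono a b : (0 < a <= b)%N -> (b <= s)%N -> (max_shift F a <= max_shift F b)%N.
  elim: b => [|b IH]; first by case: a.
  case/andP=> a0; rewrite leq_eqVlt => /orP[/eqP ->//|ab] bs.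
  by apply: leq_trans (IH _ _) (ltnW (max_lt _ _)); lia.
case=> [/lowerE|/upperE] E.
  have roots := node_lower_eq rank0 shift0 kE md F_quasi_pure mM E.
  suff H' k i : (i + k = s)%N -> (1 <= i)%N -> min_shift F i = max_shift F i.
    by move=> i /andP[i1 is_]; apply: (H' (s - i)%N) => //; lia.
  elim: k i => [|k IH] i iks i1; have is_ : (1 <= i <= s)%N by lia.
    have [j jE] := max_shift_attained F_length (proj2 (andP is_)).
    apply/eqP; rewrite eqn_leq mM // jE; have [l l1 ->] := roots i j is_.
    by rewrite min_mono //; lia.
  have [j jE] := max_shift_attained F_length (proj2 (andP is_)).
  apply/eqP; rewrite eqn_leq mM // jE; have [l l1 lE] := roots i j is_.
  have li : (l <= i)%N.
    rewrite leqNgt; apply/negP => il.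
    have : (max_shift F i < min_shift F i.+1)%N by rewrite IH ?max_lt //; lia.
    by rewrite ltnNge jE lE min_mono //; lia.
  by rewrite lE min_mono //; lia.
have roots := node_upper_eq rank0 shift0 kE md F_quasi_pure mM E.
elim=> [|i IH] // is_.
have [j jE] := min_shift_attained F_length (proj2 (andP is_)).
apply/eqP; rewrite eqn_leq mM // jE; have [l l1 lE] := roots i.+1 j is_.
rewrite lE max_mono //; last by case/andP: l1.
rewrite /= ltnNge; apply/negP => li.
have i1s : (1 <= i <= s)%N by lia.
have : (max_shift F i < max_shift F l)%N by rewrite -IH // -lE -jE min_lt.
by rewrite ltnNge max_mono //; lia.
Qed.
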